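(* For every zonoid $Z\subseteq\mathbb R^d$ there exists an orthonormal basis $\{w_i\}_{i=1}^d$ of $\mathbb R^d$ such that for any $1$-uniform cover $(\sigma_1,\dots,\sigma_m)$ of $[d]=\{1,\dots,d\}$, with $d_i=|\sigma_i|$ and $E_i=\mathrm{span}\{w_j:j\in\sigma_i\}$, we have $$\prod_{i=1}^m|P_{E_i}(Z)|\le\frac{(\sqrt d)^d}{\prod_{i=1}^m\sqrt{d_i!}}\,|Z|.$$
   Context: A zonoid is a limit, in the Hausdorff metric, of finite Minkowski sums of line segments. A $1$-uniform cover of $[d]$ is a family of (non-empty) subsets such that every element of $[d]$ belongs to exactly one of them. $P_E$ is the orthogonal projection onto $E$ and $|\cdot|$ is volume in the appropriate dimension. *)

(* Defs.v *)
From HB Require Import structures.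
From mathcomp Require Import all_boot all_order all_algebra.
From mathcomp Require Import all_classical all_reals all_analysis.

Set Implicit Arguments.
Unset Strict Implicit.
Unset Printing Implicit Defensive.

Import Order.TTheory GRing.Theory Num.Theory.
Import numFieldNormedType.Exports.

Local Open Scope classical_set_scope.
Local Open Scope ring_scope.

(* Vectors of R^n are row vectors 'rV[R]_n. The norm that the library puts on
   'rV[R]_n is the sup norm, hence the separate Euclidean norm. *)
Definition dot (R : realType) (n : nat) (u v : 'rV[R]_n) : R :=
  \sum_(i < n) u 0 i * v 0 i.

Lemma dotE (R : realType) n (u v : 'rV[R]_n) : dot u v = (u *m v^T) 0 0.
Proof. by rewrite mxE; apply: eq_bigr => i _; rewrite mxE. Qed.

Lemma dotv_eq0 (R : realType) n (u : 'rV[R]_n) : u *m u^T = 0 -> u = 0.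
Proof.
move=> /matrixP/(_ 0 0); rewrite -dotE mxE => /eqP.
rewrite psumr_eq0 => [/allP h|i _]; last by rewrite -expr2 sqr_ge0.
apply/rowP => i; rewrite mxE; apply/eqP.
by have := h i (mem_index_enum _); rewrite mulf_eq0 orbb.
Qed.

Definition enorm (R : realType) (n : nat) (u : 'rV[R]_n) : R :=
  Num.sqrt (dot u u).

Definition orthonormal_family (R : realType) (n k : nat)
    (w : 'I_k -> 'rV[R]_n) : Prop :=
  forall i j, dot (w i) (w j) = (i == j)%:R.

Definition hausdorff_dist (R : realType) (n : nat) (A B : set 'rV[R]_n)
    : \bar R :=
  let excess (A B : set 'rV[R]_n) : \bar R :=
    ereal_sup [set ereal_inf [set (enorm (a - b))%:E | b in B] | a in A] in
  maxe (excess A B) (excess B A).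

Definition segment (R : realType) (n : nat) (a b : 'rV[R]_n)
    : set 'rV[R]_n :=
  [set (1 - t) *: a + t *: b | t in `[0, 1]].

Definition minkowski_sum (R : realType) (n k : nat)
    (S : 'I_k -> set 'rV[R]_n) : set 'rV[R]_n :=
  [set \sum_(i < k) x i | x in [set x : 'I_k -> 'rV[R]_n | forall i, S i (x i)]].

Definition zonotope (R : realType) (n : nat) (Z : set 'rV[R]_n) : Prop :=
  exists (k : nat) (a b : 'I_k -> 'rV[R]_n),
    Z = minkowski_sum (fun i => segment (a i) (b i)).

(* The Hausdorff distance is a metric on the non-empty compact sets. Compactness
   of the limit has to be required, since the distance does not separate a set
   from its closure; a limit of zonotopes is automatically non-empty, as the
   distance of the empty set to a non-empty set is +oo. *)
Definition zonoid (R : realType) (n : nat) (Z : set 'rV[R]_n) : Prop :=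
  compact Z /\
  exists2 Y : nat -> set 'rV[R]_n, (forall k, zonotope (Y k))
    & hausdorff_dist (Y k) Z @[k --> \oo] --> 0%E.

(* n-dimensional Lebesgue measure as the n-fold product of the Lebesgue measure
   of R; the successor case is the formula defining the product measure \x of
   the library. R^0 is a point of mass 1. *)
Fixpoint volume (R : realType) (n : nat) : set 'rV[R]_n -> \bar R :=
  match n with
  | 0 => fun A => (\1_A 0)%:E
  | k.+1 => fun A =>
      (\int[@lebesgue_measure R]_x
         volume [set v : 'rV[R]_k | A (row_mx x%:M v)])%E
  end.

(* A subspace of R^n is, as usual in mxalgebra, the row space of a matrix.
   Its orthogonal complement is kermx E^T, the space of the u such that
   u *m E^T = 0; the projection of x is x *m orthproj E. *)
Definition orthproj (R : realType) (n : nat) (E : 'M[R]_n) : 'M[R]_n :=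
  proj_mx E (kermx E^T).

Lemma orthproj_sub (R : realType) n (E : 'M[R]_n) (x : 'rV_n) :
  (x *m orthproj E <= E)%MS.
Proof. exact: proj_mx_sub. Qed.

Lemma capmx_orth (R : realType) n (E : 'M[R]_n) : (E :&: kermx E^T = 0)%MS.
Proof.
apply/eqP; rewrite -submx0; apply/rV_subP => x; rewrite sub_capmx => /andP[].
move=> /submxP[y ->] /sub_kermxP h.
by rewrite submx0; apply/eqP/dotv_eq0; rewrite trmx_mul mulmxA h mul0mx.
Qed.

Lemma orthproj_orth (R : realType) n (E : 'M[R]_n) (x : 'rV_n) :
  (x - x *m orthproj E) *m E^T = 0.
Proof.
apply/sub_kermxP/proj_mx_compl_sub.
suff : row_full (E + kermx E^T)%MS by move=> /submx_full; apply.
have := mxrank_sum_cap E (kermx E^T).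
rewrite capmx_orth mxrank0 addn0 mxrank_ker mxrank_tr subnKC ?rank_leq_row// => h.
by apply/eqP.
Qed.

Definition orthonormal_basis_of (R : realType) (m n : nat) (E : 'M[R]_(m, n))
    : set 'M[R]_(\rank E, n) :=
  [set B | orthonormal_family (fun i => row i B) /\ (B :=: E)%MS].
Arguments orthonormal_basis_of {R m n} E _.

Lemma row_free_orthonormal (R : realType) n k (B : 'M[R]_(k, n)) : row_free B ->
  exists Q : 'M[R]_(k, n), Q *m Q^T = 1%:M /\ (Q :=: B)%MS.
Proof.
elim: k B => [|k IH] B.
  by move=> _; exists B; split; rewrite // [_ *m _]flatmx0 [RHS]flatmx0.
rewrite -[B](@vsubmxK _ 1 k); set b := usubmx _; set C := dsubmx _ => fB.
have fC : row_free C.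
  rewrite -kermx_eq0 -submx0; apply/rV_subP => x /sub_kermxP xC.
  have : row_mx (0 : 'rV_1) x *m col_mx b C = 0.
    by rewrite (@mul_row_col _ 1 1 k n) mul0mx xC addr0.
  move=> /sub_kermxP; move: fB; rewrite -kermx_eq0 => /eqP ->.
  by move=> h0; have {h0}h := submx0null h0; rewrite -(row_mxKr (0 : 'rV_1) x) h linear0 sub0mx.
have [Q [Qon QC]] := IH C fC.
pose v := b - b *m Q^T *m Q.
have vO : v *m Q^T = 0 by rewrite mulmxBl -!mulmxA Qon mulmx1 subrr.
have v0 : v != 0.
  apply: contraL fB => /eqP v0.
  have bC : (b <= C)%MS.
    by rewrite -QC; apply/submxP; exists (b *m Q^T); apply/eqP; rewrite -subr_eq0 -/v v0.
  rewrite /row_free neq_ltn; apply/orP; left.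
  rewrite -(addsmxE b C).1.
  have := mxrankS (_ : (b + C <= C)%MS); rewrite addsmx_sub bC submx_refl => /(_ isT) h.
  by rewrite ltnS (leq_trans h)// rank_leq_row.
have d0 : 0 < dot v v.
  rewrite lt_def; apply/andP; split.
    apply: contra v0 => /eqP h; apply/eqP/dotv_eq0/matrixP => i j.
    by rewrite !ord1 -dotE h mxE.
  by apply: sumr_ge0 => i _; rewrite -expr2 sqr_ge0.
pose s := (Num.sqrt (dot v v))^-1.
have s0 : s != 0 by rewrite invr_eq0 gt_eqF// sqrtr_gt0.
exists (col_mx (s *: v) Q : 'M[R]_(1 + k, n)); split.
  rewrite (@tr_col_mx _ 1 k) (@mul_col_row _ 1 k n 1 k).
  have -> : (s *: v) *m Q^T = 0 by rewrite -scalemxAl vO scaler0.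
  have -> : Q *m (s *: v)^T = 0.
    by rewrite -[Q]trmxK -trmx_mul -scalemxAl vO scaler0 trmx0.
  rewrite Qon (@scalar_mx_block _ 1 k).
  suff -> : (s *: v) *m (s *: v)^T = 1%:M by [].
  rewrite linearZ/= -scalemxAl -scalemxAr scalerA.
  apply/matrixP => i j; rewrite !ord1 mxE -dotE mxE eqxx /s -expr2 exprVn.
  by rewrite sqr_sqrtr ?ltW// mulVf// gt_eqF.
have h1 := eqmx_sym (addsmxE (s *: v) Q).
have h2 := addsmxE b C.
apply: (eqmx_trans h1); apply: (eqmx_trans _ h2); apply/eqmxP/andP; split.
  rewrite addsmx_sub andbC QC addsmxSr/=.
  apply: scalemx_sub; apply: addmx_sub; first exact: addsmxSl.
  by rewrite eqmx_opp (submx_trans (submxMl _ _))// QC addsmxSr.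
rewrite addsmx_sub andbC -QC addsmxSr/=.
have -> : b = s^-1 *: (s *: v) + b *m Q^T *m Q.
  by rewrite scalerA mulVf// scale1r subrK.
by apply: addmx_sub_adds; [exact: scalemx_sub|exact: submxMl].
Qed.

Lemma orthonormal_basis_of_neq0 (R : realType) m n (E : 'M[R]_(m, n)) :
  orthonormal_basis_of E !=set0.
Proof.
have [Q [Qon QE]] := row_free_orthonormal (row_base_free E).
exists Q; split; last by apply: (eqmx_trans QE); exact: eq_row_base.
move=> i j; have /matrixP/(_ i j) := Qon; rewrite !mxE => <-.
by apply: eq_bigr => l _; rewrite !mxE.
Qed.

(* The volume, in dimension \rank E, of a subset A of the subspace E: the
   Lebesgue measure of A in the coordinates given by an orthonormal basis. The
   basis is arbitrary: Lebesgue measure is invariant under rotations. *)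
Definition subspace_volume (R : realType) (m n : nat) (E : 'M[R]_(m, n))
    (A : set 'rV[R]_n) : \bar R :=
  let B := xget 0 (orthonormal_basis_of E) in
  volume [set c : 'rV[R]_(\rank E) | A (c *m B)].

Definition span_of (R : realType) (n k : nat) (w : 'I_k -> 'rV[R]_n)
    (s : {set 'I_k}) : 'M[R]_n :=
  (\sum_(j in s) <<w j>>)%MS.

Definition uniform_cover (k d m : nat) (sigma : 'I_m -> {set 'I_d}) : Prop :=
  (forall i, sigma i != finset.set0) /\
  (forall j : 'I_d, #|[pred i : 'I_m | j \in sigma i]| = k).

(* Main.v *)
(* For a zonotope Z with generators a, choose a matrix B of maximal determinant subject to
   sum |a B| <= 1, and put c = |a B|, M = sum (a^T a) / c. Adding a segment to a convex body K
   increases its volume by the length of the segment times the volume of the projection of K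
   along it, and det (N + c u^T u) = det N + c |u|^2 det (N restricted to the complement of u).
   By induction on the generators, a zonotope generated by the c u has volume at least
   det (sum c u^T u) if all |u| <= 1, and at most the square root of
   det (sum c u^T u) (sum c)^k / k! in dimension k. The basis w diagonalizes M. The upper bound
   applied to the projections on the E_i gives prod |P_(E_i) Z| <= sqrt (det M) / prod sqrt (d_i!),
   the lower bound applied to Z B gives |Z| >= |det B| det M, and comparing B with a matrix C
   such that C^T M C = 1 / d gives 1 <= d^d det M (det B)^2.
   For a zonoid, take the limit of enclosing zonotopes, using the compactness of the orthogonal
   group: the volumes of the projections are Lipschitz functions of the basis. *)
Require Import Defs.
From mathcomp Require Import all_boot all_order all_algebra all_fingroup.
From mathcomp Require Import all_classical all_reals all_analysis.
From mathcomp Require Import measurable_realfun.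
From mathcomp Require Import ring lra.

Set Implicit Arguments.
Unset Strict Implicit.
Unset Printing Implicit Defensive.
Import Order.TTheory GRing.Theory Num.Theory.
Import numFieldNormedType.Exports.
Local Open Scope classical_set_scope.
Local Open Scope ring_scope.

(** * Continuity of matrix functions *)

(** [volume] is an iterated integral, and its definition says nothing on the measurability of
    section volumes. They are upper semicontinuous when the set is compact, so the theory of
    [volume] is developed for compact sets. The matrix [B] puts the generators in Lewis position. No
    derivative of the determinant is taken: C competes with [B] because the inequality of arithmetic
    and geometric means bounds the sum of the |a C| by (1 + tr (C^T M C)) / 2 <= 1. The factor d^d
    is 1 / det (C^T M C). The weights c = |a B| serve twice: their sum is at most 1, so that only a
    factorial remains of the upper bound, and the vectors a B / c have norm at most 1, as the lower
    bound asks. The basis depends on M alone, so it is the same for all covers, and the determinants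
    of M on the E_i multiply to det M because M is diagonal in it. A zonoid may have empty interior.
    The enclosing zonotopes contain a small cube, whose edges make M invertible and the set of
    competing matrices bounded. *)

Lemma mx_continuous (R : realType) (T : topologicalType) m n
    (f : T -> 'M[R]_(m, n)) :
  (forall i j, continuous (fun x => f x i j)) -> continuous f.
Proof.
move=> fc x A [P Pn PA]; rewrite nbhs_filterE /=.
suff : \forall y \near x, forall i j, P i j (f y i j).
  by apply: filterS => y h; apply: PA.
apply: filter_forall => i; apply: filter_forall => j.
exact: (fc i j x _ (Pn i j)).
Qed.

Lemma mx_continuousP (R : realType) (T : topologicalType) m n
    (f : T -> 'M[R]_(m, n)) :
  continuous f <-> (forall i j, continuous (fun x => f x i j)).
Proof.
split=> [fc i j|]; last exact: mx_continuous.
move=> x; apply: (@continuous_comp _ _ _ f (fun M : 'M[R]_(m, n) => M i j)).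
  exact: fc.
exact: coord_continuous.
Qed.

Lemma sum_continuous (R : realType) (T : topologicalType) (I : Type)
    (r : seq I) (P : pred I) (f : I -> T -> R) :
  (forall i, continuous (f i)) ->
  continuous (fun x => \sum_(i <- r | P i) f i x).
Proof.
move=> fc; elim: r => [|i r IH].
  by under [X in continuous X]eq_fun do rewrite big_nil; exact: cst_continuous.
under [X in continuous X]eq_fun do rewrite big_cons.
by case: (P i) => // x; apply: continuousD; [exact: fc|exact: IH].
Qed.

Lemma prod_continuous (R : realType) (T : topologicalType) (I : Type)
    (r : seq I) (P : pred I) (f : I -> T -> R) :
  (forall i, continuous (f i)) ->
  continuous (fun x => \prod_(i <- r | P i) f i x).
Proof.
move=> fc; elim: r => [|i r IH].
  by under [X in continuous X]eq_fun do rewrite big_nil; exact: cst_continuous.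
under [X in continuous X]eq_fun do rewrite big_cons.
by case: (P i) => // x; apply: continuousM; [exact: fc|exact: IH].
Qed.

Lemma mulmx_continuous (R : realType) (T : topologicalType) m n p
    (f : T -> 'M[R]_(m, n)) (g : T -> 'M[R]_(n, p)) :
  continuous f -> continuous g -> continuous (fun x => f x *m g x).
Proof.
move=> /mx_continuousP fc /mx_continuousP gc; apply: mx_continuous => i j.
under [X in continuous X]eq_fun do rewrite mxE.
apply: sum_continuous => k x.
by apply: continuousM; [exact: fc|exact: gc].
Qed.

Lemma mulmxr_continuous (R : realType) m n p (A : 'M[R]_(n, p)) :
  continuous (fun x : 'M[R]_(m, n) => x *m A).
Proof. by apply: mulmx_continuous => x //; exact: cst_continuous. Qed.

Lemma pair_continuous (T U V : topologicalType) (f : T -> U) (g : T -> V) :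
  continuous f -> continuous g -> continuous (fun x => (f x, g x)).
Proof. by move=> fc gc x; apply: cvg_pair; [exact: fc|exact: gc]. Qed.

(** * Volume of compact sets *)

Section volume.
Variable R : realType.
Local Notation mu := (@lebesgue_measure R).

Definition section_at k (A : set 'rV[R]_k.+1) (x : R) : set 'rV[R]_k :=
  [set v | A (row_mx x%:M v)].

Lemma volumeS k (A : set 'rV[R]_k.+1) :
  volume A = (\int[mu]_x volume (section_at A x))%E.
Proof. by []. Qed.

Lemma volume_ge0 n (A : set 'rV[R]_n) : (0 <= volume A)%E.
Proof.
elim: n A => [|n IH] A; first by rewrite lee_fin /indic.
by rewrite volumeS; apply: integral_ge0 => x _; exact: IH.
Qed.

Lemma volume_set0 n : volume (@set0 'rV[R]_n) = 0%E.
Proof.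
elim: n => [|n IH]; first by rewrite /= indic0.
by rewrite volumeS; under eq_integral do rewrite IH; rewrite integral0.
Qed.

Lemma split1_compact k (K : set 'rV[R]_k.+1) : compact K ->
  compact [set p : R * 'rV[R]_k | K (row_mx p.1%:M p.2)].
Proof.
move=> cK.
have -> : [set p : R * 'rV[R]_k | K (row_mx p.1%:M p.2)] =
    (fun u : 'rV[R]_(1 + k) => (u 0 0, rsubmx u)) @` K.
  apply/seteqP; split => [[x v]/= Kxv|p [u Ku <-]/=].
    exists (row_mx x%:M v) => //; rewrite row_mxKr; congr (_, _).
    by rewrite (_ : 0 = lshift k (0 : 'I_1)) ?row_mxEl ?mxE//; exact/val_inj.
  suff -> : row_mx (u 0 0)%:M (@rsubmx _ 1 1 k u) = u by [].
  rewrite -[RHS](@hsubmxK _ 1 1 k); congr row_mx; apply/rowP => i.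
  by rewrite ord1 !mxE eqxx /=; congr (u _ _); exact/val_inj.
apply: continuous_compact => //; apply: continuous_subspaceT.
apply: (@pair_continuous _ _ _ (fun u : 'rV[R]_(1 + k) => u 0 0)
  (fun u : 'rV[R]_(1 + k) => rsubmx u)).
  exact: (@coord_continuous _ 1 (1 + k) 0 0).
apply: (@mx_continuous _ _ _ _ (fun x : 'rV[R]_(1 + k) => rsubmx x)) => i j.
by under [X in continuous X]eq_fun do rewrite mxE; exact: coord_continuous.
Qed.

Lemma snd_compact (X : topologicalType) k (K : set (X * 'rV[R]_k)) :
  compact K -> compact (snd @` K).
Proof.
move=> cK; apply: continuous_compact => //.
by apply: continuous_subspaceT => u; exact: cvg_snd.
Qed.

Lemma slice_compact (X : normedModType R) k (K : set (X * 'rV[R]_k)) (x : X) :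
  compact K -> compact [set v | K (x, v)].
Proof.
move=> cK.
have -> : [set v | K (x, v)] = snd @` (K `&` [set p | p.1 = x]).
  apply/seteqP; split => [v/= Kv|v [[y w]/= [Kp <- <-]]//].
  by exists (x, v).
apply: snd_compact; apply: compact_closedI => //.
apply: (@closed_comp _ _ (fun p : X * 'rV[R]_k => p.1) [set x]).
  by move=> p _; exact: cvg_fst.
exact/accessible_closed_set1/hausdorff_accessible/norm_hausdorff.
Qed.

Lemma section_compact k (K : set 'rV[R]_k.+1) x :
  compact K -> compact (section_at K x).
Proof. by move=> /split1_compact/(@slice_compact R^o _ _ x). Qed.

(** Continuity from above on compact sets. It is named because it is an induction hypothesis on the
    dimension before it is a theorem. *)
Definition cvg_on_decreasing n := forall (K : nat -> set 'rV[R]_n),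
  (forall j, compact (K j)) -> (forall j, K j.+1 `<=` K j) ->
  volume (K j) @[j --> \oo] --> volume (\bigcap_j K j).

(** The slices over points near [x] lie in the projection [C j] of a thin tube of [K] around [x],
    and these projections decrease to the slice at [x]. The base is a general normed space: the line
    serves for sections, the plane for exchanging two coordinates. *)
Lemma usc_slices n : cvg_on_decreasing n ->
  (forall A B : set 'rV[R]_n, compact A -> compact B -> A `<=` B ->
     volume A <= volume B)%E ->
  forall (X : normedModType R) (K : set (X * 'rV[R]_n)), compact K ->
  lower_semicontinuous (fun x => (- volume [set v | K (x, v)])%E).
Proof.
move=> dc mono X K cK x a.
rewrite lteNr -EFinN => ax.
pose C j : set 'rV[R]_n :=
  snd @` (K `&` [set p | `|p.1 - x| <= (j.+1%:R)^-1]).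
have cC j : compact (C j).
  apply: snd_compact; apply: compact_closedI => //.
  apply: (@closed_comp _ _ (fun p : X * 'rV[R]_n => `|p.1 - x|)
    [set r | r <= (j.+1%:R)^-1]); last exact: closed_le.
  move=> p _; apply: cvg_norm; apply: cvgB; last exact: cvg_cst.
  exact: cvg_fst.
have CS j : C j.+1 `<=` C j.
  move=> _ [p [Kp /= pj] <-]; exists p => //; split => //=.
  by apply: (le_trans pj); rewrite lef_pV2 ?posrE// ler_nat.
have Cx : \bigcap_j C j = [set v | K (x, v)].
  apply/seteqP; split => [v Cv|v Kv j _]; last first.
    by exists (x, v) => //; split => //=; rewrite subrr normr0.
  (* A point [v] of every [C j] comes from points of [K] whose base points tend to [x], so (x, v) is
     in the closure of [K]. *)
  have /closure_id -> : closed K by exact: compact_closed.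
  move=> U /nbhs_ballP[e /= e0 eU].
  have [j _ /(_ j (leqnn j)) /= je] := near_infty_natSinv_lt (PosNum e0).
  have [p [Kp /= pj] pv] := Cv j I.
  exists p; split => //; apply: eU; split => /=.
    by rewrite -ball_normE/= distrC (le_lt_trans pj).
  by rewrite pv; exact: ballxx.
have := dc C cC CS; rewrite Cx => Ccvg.
have ltn : nbhs (volume [set v | K (x, v)]) [set y | (y < (- a)%:E)%E].
  by apply: open_nbhs_nbhs; split => //; exact: open_ereal_lt_ereal.
have [j _ jV] := Ccvg _ ltn.
exists (ball x (j.+1%:R)^-1); first by apply: nbhsx_ballx; rewrite invr_gt0.
move=> y xy; rewrite lteNr -EFinN; apply: (le_lt_trans _ (jV j (leqnn j))).
apply: mono => //; first exact: slice_compact.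
move=> v /= Kv; exists (y, v) => //; split => //=.
by move: xy; rewrite -ball_normE/= distrC => /ltW.
Qed.

End volume.

Lemma mx_norm_leP (R : realType) m n (A : 'M[R]_(m, n)) (r : R) : 0 <= r ->
  reflect (forall i j, `|A i j| <= r) (`|A| <= r).
Proof.
move=> r0; apply: (iffP idP) => [Ar i j|Ar].
  by apply: le_trans Ar; rewrite [leRHS]mx_normrE (le_bigmax _ (fun p => `|A p.1 p.2|) (i, j)).
by rewrite [leLHS]mx_normrE bigmax_le.
Qed.

Lemma row_mx_ord0 (R : realType) k (x : R) (v : 'rV[R]_k) :
  (row_mx x%:M v : 'rV_k.+1) 0 0 = x.
Proof.
have := @row_mxEl R 1 1 k x%:M v 0 0; rewrite [X in _ = X -> _]mxE eqxx mulr1n => e; apply: etrans e.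
by apply: (congr1 (fun i => (row_mx x%:M v : 'rV_k.+1) 0 i)); exact: val_inj.
Qed.

Lemma row_mx_lift0 (R : realType) k (x : R) (v : 'rV[R]_k) j :
  (row_mx x%:M v : 'rV_k.+1) 0 (lift ord0 j) = v 0 j.
Proof.
apply: etrans (@row_mxEr R 1 1 k x%:M v 0 j).
by apply: (congr1 (fun i => (row_mx x%:M v : 'rV_k.+1) 0 i)); exact: val_inj.
Qed.

Section volume.
Variable R : realType.
Local Notation mu := (@lebesgue_measure R).

Definition section_volume n (K : set 'rV[R]_n.+1) : R -> \bar R :=
  fun x => volume (section_at K x).

(** These clauses go through the induction on the dimension only together: measurability of section
    volumes in dimension n+1 rests on the first and third in dimension n, and the second, uniform
    over the compact sets of a ball, gives the integrable majorant for the third. *)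
Definition volume_regular n :=
  [/\ forall A B : set 'rV[R]_n, compact A -> compact B -> A `<=` B ->
        (volume A <= volume B)%E,
      forall r : R, exists C : R, forall K : set 'rV[R]_n, compact K ->
        (forall v, K v -> `|v| <= r) -> (volume K <= C%:E)%E
    & cvg_on_decreasing R n].

Lemma volume_regular_measurable_section n (K : set 'rV[R]_n.+1) :
  volume_regular n -> compact K ->
  measurable_fun setT (section_volume K).
Proof.
move=> [mono _ dc] cK.
have := lower_semicontinuous_measurable
  (usc_slices dc mono (split1_compact cK : @compact (R^o * _)%type _)).
move=> /(measurableT_comp (@oppe_measurable R setT)); congr measurable_fun.
by apply/funext => x /=; rewrite oppeK.
Qed.

Lemma volume_regularP n : volume_regular n.
Proof.
elim: n => [|n IH].
  split=> [A B _ _ AB|r|K cK KS].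
  - rewrite lee_fin !indicE ler_nat; case: (boolP (_ \in A)) => // /set_mem/AB.
    by move=> /mem_set ->.
  - by exists 1 => K _ _ /=; rewrite lee_fin indicE lern1 leq_b1.
  - have [[N KN]|K0] := pselect (exists N, ~ K N 0).
      rewrite [X in _ --> X](_ : _ = 0%E); last first.
        by rewrite /= indicE memNset// => /(_ N I).
      apply: cvg_near_cst; exists N => //= j /= Nj.
      rewrite indicE memNset// => Kj; apply: KN.
      by move: Nj => /subnKC jE; rewrite -jE in Kj; elim: (j - N)%N Kj => [|l IHl];
        rewrite ?addn0// addnS => /KS.
    have {}K0 j : K j 0 by apply: contrapT => ?; apply: K0; exists j.
    rewrite [X in _ --> X](_ : _ = 1%E); last first.
      by rewrite /= indicE mem_set.
    by apply: cvg_near_cst; apply: nearW => j; rewrite /= indicE mem_set.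
have [mono bnd dc] := IH.
have mS (K : set 'rV[R]_n.+1) := @volume_regular_measurable_section n K IH.
(* In the sup norm, a bound on a vector bounds its first coordinate and the rest separately, so the
   sections vanish outside [-r, r]. The same majorant gives the bound on volumes and dominated
   convergence. *)
have bnd1 r : exists2 C : R, 0 <= C & forall K : set 'rV[R]_n.+1, compact K ->
    (forall v, K v -> `|v| <= r) -> forall x,
    (volume (section_at K x) <= C%:E * (\1_(`[-r, r]) x)%:E)%E.
  have [C HC] := bnd r; exists (Num.max C 0); first by rewrite le_max lexx orbT.
  move=> K cK Kr x.
  have KX v : section_at K x v -> `|x| <= r /\ `|v| <= r.
    move=> /Kr; have [r0|r0] := leP 0 r; last first.
      by move=> /le_lt_trans/(_ r0); rewrite normr_lt0.
    move=> /(mx_norm_leP _ r0) h; split.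
      by have := h 0 0; rewrite row_mx_ord0.
    apply/mx_norm_leP => // i j; have := h i (lift ord0 j).
    by rewrite [i]ord1 row_mx_lift0.
  rewrite indicE; case: (boolP (x \in _)) => xr /=.
    rewrite mule1; apply: (le_trans (HC _ (@section_compact _ _ _ x cK) _)).
      by move=> v /KX[].
    by rewrite lee_fin le_max lexx.
  rewrite (_ : section_at K x = set0) ?volume_set0 ?mule0//.
  apply/seteqP; split => // v /KX[xr' _]; move: xr.
  by rewrite notin_setE /= in_itv /= -ler_norml xr'.
have bndI (C r : R) : 0 <= C ->
    (\int[mu]_x (C%:E * (\1_(`[-r, r]%classic) x)%:E))%E =
    (C%:E * mu `[(- r)%R, r]%classic)%E.
  move=> C0; rewrite ge0_integralZl//=; last first.
    by apply/measurable_EFinP; exact: measurable_indic.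
  by rewrite integral_indic// setIT.
have finI (r : R) : mu `[(- r)%R, r]%classic \is a fin_num.
  by rewrite lebesgue_measure_itv/=; case: ifP.
split=> [A B cA cB AB|r|K cK KS].
- rewrite !volumeS; apply: ge0_le_integral => //.
  + by move=> x _; exact: volume_ge0.
  + exact: mS.
  + exact: mS.
  + move=> x _; apply: mono; try exact: section_compact.
    by move=> v; exact: AB.
- have [C C0 HC] := bnd1 r.
  exists (C * fine (mu `[(- r)%R, r]%classic)) => K cK Kr.
  rewrite volumeS EFinM fineK ?finI// -bndI//; apply: ge0_le_integral => //=.
  + by move=> x _; exact: volume_ge0.
  + exact: mS.
  + apply: emeasurable_funM; first exact: measurable_cst.
    by apply/measurable_EFinP; exact: measurable_indic.
  + by move=> x _; exact: HC.
- have cI : compact (\bigcap_j K j).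
    apply: (subclosed_compact _ (cK 0)); last by move=> v; exact.
    apply: closed_bigI => j _; exact: compact_closed.
  have KI j : \bigcap_j K j `<=` K j by move=> v; exact.
  have [r [_ /(_ (r + 1))]] := compact_bounded (cK 0).
  rewrite ltrDl ltr01 => /(_ isT) Kr.
  have [C C0 HC] := bnd1 (r + 1).
  apply: (@dominated_cvg _ _ _ mu setT _ (fun j => section_volume (K j)) _
    (fun x => C%:E * (\1_(`[- (r + 1), r + 1]%classic) x)%:E)%E) => //=.
  + by move=> j; exact: mS.
  + move=> x _; apply: (dc (fun j => section_at (K j) x)) => [j|j v].
      exact: section_compact.
    exact: KS.
  + apply/integrableP; split.
      apply: emeasurable_funM; first exact: measurable_cst.
      by apply/measurable_EFinP; exact: measurable_indic.
    under eq_integral do rewrite gee0_abs ?mule_ge0 ?lee_fin//.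
    by rewrite bndI// ltey_eq fin_numM ?finI.
  + move=> j x _; rewrite gee0_abs ?volume_ge0//; apply: HC => // v Kv.
    apply: Kr; elim: j Kv => // j IHj /KS; exact: IHj.
Qed.

Lemma volume_compact_le n (A B : set 'rV[R]_n) : compact A -> compact B ->
  A `<=` B -> (volume A <= volume B)%E.
Proof. move=> cA cB; have [h _ _] := volume_regularP n; exact: h. Qed.

Lemma volume_bounded n (r : R) : exists C : R, forall K : set 'rV[R]_n,
  compact K -> (forall v, K v -> `|v| <= r) -> (volume K <= C%:E)%E.
Proof. by have [_ h _] := volume_regularP n; exact: h. Qed.

Lemma volume_decreasing_cvg n (K : nat -> set 'rV[R]_n) :
  (forall j, compact (K j)) -> (forall j, K j.+1 `<=` K j) ->
  volume (K j) @[j --> \oo] --> volume (\bigcap_j K j).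
Proof. by have [_ _ h] := volume_regularP n; exact: h. Qed.

Lemma measurable_section_volume n (K : set 'rV[R]_n.+1) :
  compact K -> measurable_fun setT (section_volume K).
Proof.
move=> cK; apply: volume_regular_measurable_section => //.
exact: volume_regularP.
Qed.

Lemma volume_fin_num n (K : set 'rV[R]_n) : compact K ->
  volume K \is a fin_num.
Proof.
move=> cK; have [r [_ /(_ (r + 1))]] := compact_bounded cK.
rewrite ltrDl ltr01 => /(_ isT) Kr.
have [C /(_ K cK Kr) KC] := volume_bounded n (r + 1).
by rewrite ge0_fin_numE ?volume_ge0// (le_lt_trans KC)// ltry.
Qed.


End volume.

(** * Behaviour of volume under linear maps *)

Section affine.
Variable R : realType.
Local Notation mu := (@lebesgue_measure R).
Variables (s a : R).
Hypothesis s0 : s != 0.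

Let phi (x : measurableTypeR R) : measurableTypeR R := x * s + a.

Let mphi : measurable_fun setT phi.
Proof.
suff c : continuous (fun x : R => x * s + a) by exact: continuous_measurable_fun c.
move=> x; apply: cvgD; last exact: cvg_cst.
by apply: cvgMl; exact: cvg_id.
Qed.

Let nu : {measure set (measurableTypeR R) -> \bar R} :=
  measure_function_pushforward__canonical__measure_function_Measure mu mphi.

Let abs_s : {nonneg R} := NngNum (normr_ge0 s).

Lemma lebesgue_measure_affine (A : set (measurableTypeR R)) : measurable A ->
  mu A = mscale abs_s nu A.
Proof.
move=> mA; apply: lebesgue_measure_unique => //= _ [[c b]] _ <-.
rewrite /mscale /= /pushforward.
(* Despite the names, the first case is s < 0 and the second s > 0. A negative factor moves the
   closed end of the half-open interval to the other side, without changing its length. *)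
have [s_gt0|s_lt0|/eqP] := ltgtP s 0; last by rewrite (negbTE s0).
- rewrite (_ : phi @^-1` _ = `[(b - a) / s, (c - a) / s[%classic); last first.
    apply/seteqP; split => x /=; rewrite !in_itv /= /phi.
      by rewrite ler_ndivrMr // ltr_ndivlMr// lerBrDr ltrBlDr andbC.
    by rewrite ler_ndivrMr // ltr_ndivlMr// lerBrDr ltrBlDr andbC.
  rewrite !lebesgue_measure_itv/= !lte_fin ltr_ndivrMr// divfK// ltrD2r.
  case: ifP => cb; last by rewrite mule0.
  rewrite -!EFinD -EFinM ltr0_norm//; congr EFin; field => //.
- rewrite (_ : phi @^-1` _ = `](c - a) / s, (b - a) / s]%classic); last first.
    apply/seteqP; split => x /=; rewrite !in_itv /= /phi.
      by rewrite ltr_pdivrMr // ler_pdivlMr// lerBrDr ltrBlDr.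
    by rewrite ltr_pdivrMr // ler_pdivlMr// lerBrDr ltrBlDr.
  rewrite !lebesgue_measure_itv/= !lte_fin ltr_pdivrMr// divfK// ltrD2r.
  case: ifP => cb; last by rewrite mule0.
  rewrite -!EFinD -EFinM gtr0_norm//; congr EFin; field => //.
Qed.

Lemma integral_affine (f : R -> \bar R) : measurable_fun setT f ->
  (forall x, 0 <= f x)%E ->
  (\int[mu]_x f x = `|s|%:E * \int[mu]_x f (x * s + a)%R)%E.
Proof.
move=> mf f0.
rewrite (@eq_measure_integral _ _ _ _ (mscale abs_s nu) mu); last first.
  by move=> A mA _; exact: lebesgue_measure_affine.
by rewrite ge0_integral_mscale//= ge0_integral_pushforward.
Qed.

End affine.

Lemma compact_preimage_linear (R : realType) n (K : set 'rV[R]_n) (T : 'M[R]_n)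
    (p : 'rV[R]_n) : T \in unitmx -> compact K ->
  compact [set v | K (v *m T + p)].
Proof.
move=> uT cK.
have -> : [set v | K (v *m T + p)] = (fun v => (v - p) *m invmx T) @` K.
  apply/seteqP; split => [v /= Kv|_ [v Kv <-]/=].
    by exists (v *m T + p) => //; rewrite addrK mulmxK.
  by rewrite mulmxKV// subrK.
apply: continuous_compact => //; apply: continuous_subspaceT.
apply: mulmx_continuous; last by move=> x; exact: cst_continuous.
move=> x; apply: (@continuousB _ 'rV[R]_n _ id (cst p)).
  exact: cvg_id.
exact: cst_continuous.
Qed.

(** An open set of the plane is a countable union of squares with rational centre and radius. An
    index whose square leaves [U] contributes the empty set. *)
Lemma open_prod_measurable (R : realType) (U : set (R * R)) : open U ->
  measurable (U : set (measurableTypeR R * measurableTypeR R)).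
Proof.
move=> oU.
pose B (t : rat * rat * rat) : set (R * R) :=
  ball (ratr t.1.1 : R) (ratr t.2 : R) `*` ball (ratr t.1.2 : R) (ratr t.2 : R).
have -> : U = \bigcup_t (if `[< B t `<=` U >] then B t else set0).
  apply/seteqP; split => [[x y] Uxy|p [t _]]; last by case: asboolP => [BU /BU|_ []].
  have [e /= e0 eU] : exists2 e : R, 0 < e & ball (x, y) e `<=` U.
    by apply/nbhs_ballP; exact: open_nbhs_nbhs.
  have [r re] := @rat_in_itvoo R 0 (e / 2) ltac:(by rewrite divr_gt0).
  have [p px] := @rat_in_itvoo R (x - ratr r) x
    ltac:(by move: re; rewrite in_itv/= => /andP[? _]; rewrite ltrBlDr ltrDl).
  have [q qy] := @rat_in_itvoo R (y - ratr r) y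
    ltac:(by move: re; rewrite in_itv/= => /andP[? _]; rewrite ltrBlDr ltrDl).
  move: re px qy; rewrite !in_itv/= => /andP[r0 re] /andP[p1 p2] /andP[q1 q2].
  exists (p, q, r) => //.
  have BE a c z : ball (a : R) c z = (`|a - z| < c) :> Prop by rewrite -ball_normE.
  rewrite asboolT /B; last first.
    move=> [a b]/= []; rewrite !BE !ltr_norml => /andP[a1 a2] /andP[b1 b2].
    apply: eU; split => /=; rewrite BE ltr_norml; apply/andP; split; lra.
  by split; rewrite /= BE ltr_norml; apply/andP; split; lra.
apply: countable_bigcupT_measurable => // t.
by case: asboolP => // _; apply: measurableX; exact: measurable_ball.
Qed.

Section volume.
Variable R : realType.
Local Notation mu := (@lebesgue_measure R).

Lemma row_mx1_eta k (p : 'rV[R]_k.+1) :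
  p = row_mx (p 0 0)%:M (\row_j p 0 (lift ord0 j)).
Proof.
apply/rowP => i; case: (unliftP 0 i) => [j|] ->.
  by rewrite row_mx_lift0 mxE.
by rewrite row_mx_ord0.
Qed.

Lemma volume_translate n (K : set 'rV[R]_n) p : compact K ->
  volume [set v | K (v + p)] = volume K.
Proof.
elim: n K p => [|n IH] K p cK.
  by rewrite (_ : [set v | K (v + p)] = K)//; apply/funext => v /=; congr K; rewrite [LHS]thinmx0 [RHS]thinmx0.
rewrite (row_mx1_eta p); set a := p 0 0; set q := \row_j _.
rewrite !volumeS (@integral_affine R 1 a (oner_neq0 R) (section_volume K)); last 2 first.
- exact: measurable_section_volume.
- by move=> x; exact: volume_ge0.
rewrite normr1 mul1e; apply: eq_integral => x _.
rewrite mulr1 /section_volume -(IH (section_at K (x + a)) q); last exact: section_compact.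
congr volume; apply/seteqP.
have E v : (row_mx x%:M v + row_mx a%:M q : 'rV[R]_(1 + n)) = row_mx (x + a)%:M (v + q).
  by rewrite add_row_mx raddfD.
by split=> v; rewrite /section_at/= E.
Qed.

(** Stated with a preimage rather than an image: a section of a preimage is a preimage of a section,
    and compositions need no inverse. *)
Definition scales_volume n (T : 'M[R]_n) := forall K : set 'rV[R]_n, compact K ->
  volume K = (`|\det T|%:E * volume [set v | K (v *m T)])%E.

Lemma compact_preimage_mulmx n (K : set 'rV[R]_n) (T : 'M[R]_n) :
  T \in unitmx -> compact K -> compact [set v | K (v *m T)].
Proof.
move=> uT /(@compact_preimage_linear _ _ _ _ 0 uT); congr compact.
by apply/funext => v /=; rewrite addr0.
Qed.

Lemma scales_volumeM n (T S : 'M[R]_n) : S \in unitmx ->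
  scales_volume T -> scales_volume S -> scales_volume (T *m S).
Proof.
move=> uS gT gS K cK; rewrite gS// gT; last exact: compact_preimage_mulmx.
rewrite det_mulmx normrM EFinM muleCA muleA; congr (_ * volume _)%E.
by apply/funext => v /=; rewrite mulmxA.
Qed.

Lemma scales_volume1 n : scales_volume (1%:M : 'M[R]_n).
Proof.
move=> K cK; rewrite det1 normr1 mul1e; congr volume.
by apply/funext => v /=; rewrite mulmx1.
Qed.

Lemma scales_volume_block n s (T : 'M[R]_n) : s != 0 -> T \in unitmx ->
  scales_volume T -> @scales_volume n.+1 (block_mx s%:M 0 0 T : 'M[R]_(1 + n)).
Proof.
move=> s0 uT gT K cK.
set S := block_mx _ _ _ _.
have detS : \det S = s * \det T by rewrite det_ublock det_scalar1.
have uS : (S : 'M[R]_n.+1) \in unitmx.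
  by rewrite unitmxE detS unitrM unitfE s0 -unitmxE.
have E x v : (row_mx x%:M v *m S : 'rV[R]_(1 + n)) = row_mx (x * s)%:M (v *m T).
  by rewrite mul_row_block !mulmx0 addr0 add0r -scalar_mxM.
rewrite !volumeS (@integral_affine R s 0 s0 (section_volume K)); last 2 first.
- exact: measurable_section_volume.
- by move=> x; exact: volume_ge0.
rewrite [X in _ = (`|X|%:E * _)%E](_ : _ = s * \det T)// normrM EFinM -muleA; congr (_ * _)%E.
rewrite -ge0_integralZl//; last 2 first.
- by apply: measurable_section_volume; exact: compact_preimage_mulmx.
- by move=> x _; exact: volume_ge0.
apply: eq_integral => x _; rewrite addr0 /section_volume gT; last exact: section_compact.
by congr (_ * volume _)%E; apply/funext => v; rewrite /section_at /= E.
Qed.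

(** An upper shear only translates the section at [x], by [x *: u]. *)
Lemma scales_volume_shear n (u : 'rV[R]_n) :
  @scales_volume n.+1 (block_mx 1%:M u 0 1%:M : 'M[R]_(1 + n)).
Proof.
move=> K cK.
rewrite [X in _ = (`|X|%:E * _)%E](_ : _ = 1); last first.
  by apply: (etrans (@det_ublock R 1 n 1%:M u 1%:M)); rewrite !det1 mulr1.
rewrite normr1 mul1e !volumeS; apply: eq_integral => x _.
rewrite -(@volume_translate _ (section_at K x) (x *: u)); last exact: section_compact.
congr volume; apply/funext => v; rewrite /section_at /=; congr K.
by rewrite (@mul_row_block _ 1 1 n 1 n) mulmx0 addr0 !mulmx1 mul_scalar_mx addrC.
Qed.

Lemma split2_compact k (K : set 'rV[R]_k.+2) : compact K ->
  compact [set p : (R * R) * 'rV[R]_k |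
    K (row_mx p.1.1%:M (row_mx p.1.2%:M p.2 : 'rV_k.+1))].
Proof.
move=> cK.
have -> : [set p : (R * R) * 'rV[R]_k |
    K (row_mx p.1.1%:M (row_mx p.1.2%:M p.2 : 'rV_k.+1))] =
  (fun u : 'rV[R]_k.+2 => ((u 0 0, u 0 (lift ord0 ord0)),
     \row_j u 0 (lift ord0 (lift ord0 j)))) @` K.
  apply/seteqP; split => [[[x y] v]/= Kxv|p [u Ku <-]/=].
    exists (row_mx x%:M (row_mx y%:M v : 'rV_k.+1)) => //.
    rewrite row_mx_ord0 row_mx_lift0 row_mx_ord0; congr (_, _).
    by apply/rowP => j; rewrite mxE !row_mx_lift0.
  suff <- : u = row_mx (u 0 0)%:M (row_mx (u 0 (lift ord0 ord0))%:M
     (\row_j u 0 (lift ord0 (lift ord0 j))) : 'rV_k.+1) by [].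
  apply/rowP => i; case: (unliftP 0 i) => [j|] ->; last by rewrite row_mx_ord0.
  rewrite row_mx_lift0; case: (unliftP 0 j) => [l|] ->; last by rewrite row_mx_ord0.
  by rewrite row_mx_lift0 mxE.
apply: continuous_compact => //; apply: continuous_subspaceT.
apply: pair_continuous; first by apply: pair_continuous; exact: coord_continuous.
apply: mx_continuous => i j.
by under [X in continuous X]eq_fun do rewrite mxE; exact: coord_continuous.
Qed.

(** Tonelli for the first two coordinates. Joint measurability comes from semicontinuity of slices
    over the plane, open sets of the plane being measurable for the product structure. *)
Lemma volume_swap n (K : set 'rV[R]_n.+2) : compact K ->
  volume K = (\int[mu]_x \int[mu]_y volume
     [set v | K (row_mx y%:M (row_mx x%:M v : 'rV_n.+1))])%E.
Proof.
move=> cK.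
pose f (p : R * R) : \bar R :=
  volume [set v | K (row_mx p.1%:M (row_mx p.2%:M v : 'rV_n.+1))].
have f0 p : (0 <= f p)%E by exact: volume_ge0.
suff mf : measurable_fun setT (f : measurableTypeR R * measurableTypeR R -> \bar R).
  by have := @fubini_tonelli _ _ _ _ _ mu mu f mf f0.
have [mono _ dc] := volume_regularP R n.
have /lower_semicontinuousP lf := @usc_slices R n dc mono (R^o * R^o)%type _
  (split2_compact cK).
have mf : measurable_fun setT (fun p : measurableTypeR R * measurableTypeR R => - f p)%E.
  apply: (measurability _ (ErealGenOInfty.measurableE R)).
  move=> /= _ [_ [a ->]] <-; apply: measurableI => //.
  apply: open_prod_measurable; rewrite preimage_itvoy; exact: lf.
move: mf => /(measurableT_comp (@oppe_measurable R setT)); congr measurable_fun.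
by apply/funext => x /=; rewrite oppeK.
Qed.

End volume.

(** * Change of variables for invertible matrices *)

Section gl.
Variable R : realType.

Lemma row_mx_swap n (x y : R) (v : 'rV[R]_n) :
  (row_mx x%:M (row_mx y%:M v : 'rV[R]_n.+1) : 'rV[R]_n.+2) *m
    tperm_mx 0 (lift ord0 ord0) = row_mx y%:M (row_mx x%:M v : 'rV[R]_n.+1).
Proof.
rewrite -(@xcolE _ 1 n.+2).
apply/rowP => i; rewrite [LHS]mxE; case: tpermP => [->|->|/eqP i0 /eqP i1].
- by rewrite row_mx_lift0 !row_mx_ord0.
- by rewrite row_mx_lift0 !row_mx_ord0.
case: (unliftP 0 i) i0 i1 => [j|] -> //; case: (unliftP 0 j) => [l|] -> // _ _.
by rewrite !row_mx_lift0.
Qed.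

Lemma scales_volume_swap n :
  scales_volume (tperm_mx 0 (lift ord0 ord0) : 'M[R]_n.+2).
Proof.
move=> K cK; rewrite det_perm normr_sign mul1e volume_swap//.
rewrite !volumeS; apply: eq_integral => x _; rewrite volumeS.
apply: eq_integral => y _; congr volume; apply/funext => v; rewrite /section_at/=.
by congr K; rewrite row_mx_swap.
Qed.

Lemma shear_unitmx n (u : 'rV[R]_n) :
  (block_mx 1%:M u 0 1%:M : 'M[R]_(1 + n)) \in unitmx.
Proof. by rewrite unitmxE det_ublock !det1 mulr1 unitr1. Qed.

Lemma lshear_unitmx n (u : 'cV[R]_n) :
  (block_mx 1%:M 0 u 1%:M : 'M[R]_(1 + n)) \in unitmx.
Proof. by rewrite unitmxE det_lblock !det1 mulr1 unitr1. Qed.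

Lemma block_unitmx n s (T : 'M[R]_n) : s != 0 -> T \in unitmx ->
  (block_mx s%:M 0 0 T : 'M[R]_(1 + n)) \in unitmx.
Proof.
by move=> s0 uT; rewrite unitmxE det_ublock det_scalar1 unitrM unitfE s0 -unitmxE.
Qed.

Lemma unitmx_col0 n (u : 'cV[R]_n.+1) : u != 0 ->
  exists2 T : 'M[R]_n.+1, T \in unitmx & u = T *m delta_mx 0 0.
Proof.
move=> u0; have r1 : \rank u = 1%N.
  by apply/eqP; rewrite eqn_leq rank_leq_col lt0n mxrank_eq0.
exists (row_ebase u 0 0 *: col_ebase u).
  rewrite unitmxZ ?col_ebase_unit//.
  by have := row_ebase_unit u; rewrite unitmxE det_mx11.
rewrite -[LHS]mulmx_ebase r1.
have -> : row_ebase u = (row_ebase u 0 0)%:M :> 'M[R]_1 by rewrite [LHS]mx11_scalar.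
rewrite mul_mx_scalar -scalemxAl mxE eqxx mulr1n; congr (_ *: (_ *m _)).
apply/colP => i; rewrite !mxE; case: i => -[|i] //=.
Qed.

(** Exchanging the first two coordinates turns this lower shear into an upper one. *)
Lemma scales_volume_lshear1 n :
  @scales_volume R n.+2 (block_mx 1%:M 0 (delta_mx 0 0) 1%:M : 'M[R]_(1 + n.+1)).
Proof.
set P := (tperm_mx 0 (lift ord0 ord0) : 'M[R]_n.+2).
have uP : P \in unitmx by exact: unitmx_perm.
set U := (block_mx 1%:M (delta_mx 0 0) 0 1%:M : 'M[R]_(1 + n.+1)).
rewrite [X in scales_volume X](_ : _ = P *m U *m P).
  apply: scales_volumeM => //; last exact: scales_volume_swap.
  apply: scales_volumeM; last 2 first.
  - exact: scales_volume_swap.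
  - exact: scales_volume_shear.
  exact: shear_unitmx.
apply/row_matrixP => i; rewrite !rowE -!mulmxA; move: (delta_mx _ _) => u.
rewrite [u]row_mx1_eta; set x := u 0 0; set w := \row_j _; rewrite [w]row_mx1_eta.
set y := w 0 0; set v := \row_j _; rewrite [in RHS]mulmxA row_mx_swap.
rewrite [in RHS]mulmxA (@mul_row_block _ 1 1 n.+1 1 n.+1).
rewrite (@mul_row_block _ 1 1 n.+1 1 n.+1).
rewrite !(mulmx1, mulmx0, addr0, add0r).
have -> : y%:M *m delta_mx 0 0 + row_mx x%:M v = row_mx (x + y)%:M v :> 'rV[R]_n.+1.
  apply/rowP => j; rewrite [LHS]mxE mul_scalar_mx [X in X + _ = _]mxE [X in _ * X + _]mxE.
  case: (unliftP 0 j) => [l|] ->.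
    by rewrite !row_mx_lift0 /= mulr0 add0r.
  by rewrite !row_mx_ord0 eqxx mulr1 addrC.
rewrite row_mx_swap; congr (@row_mx _ 1 1 n.+1 _ _).
apply/rowP => j; rewrite [j]ord1 !mxE big_ord_recl row_mx_ord0 !mxE !eqxx mulr1n mulr1.
rewrite big1 ?addr0// => l _; rewrite !mxE /= mulr0//.
Qed.

(** A nonzero column is [T] times the first basis column, so conjugation by the block matrix of 1
    and [T] reduces to [scales_volume_lshear1]. *)
Lemma scales_volume_lshear n (u : 'cV[R]_n.+1) :
  (forall T : 'M[R]_n.+1, T \in unitmx -> scales_volume T) ->
  @scales_volume R n.+2 (block_mx 1%:M 0 u 1%:M : 'M[R]_(1 + n.+1)).
Proof.
move=> IH; have [->|/unitmx_col0[T uT ->]] := eqVneq u 0.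
  by rewrite -(@scalar_mx_block _ 1 n.+1); exact: scales_volume1.
pose D (S : 'M[R]_n.+1) := (block_mx 1%:M 0 0 S : 'M[R]_(1 + n.+1)).
rewrite [X in scales_volume X](_ : _ = D T *m
   (block_mx 1%:M 0 (delta_mx 0 0) 1%:M : 'M[R]_(1 + n.+1)) *m D (invmx T)); last first.
  rewrite /D (@mulmx_block _ 1 n.+1 1 n.+1 1 n.+1) (@mulmx_block _ 1 n.+1 1 n.+1 1 n.+1).
  by rewrite !(mulmx1, mul1mx, mulmx0, mul0mx, addr0, add0r) mulmxV.
apply: scales_volumeM.
- by apply: block_unitmx; rewrite ?oner_neq0 ?unitmx_inv.
- apply: scales_volumeM.
  + exact: lshear_unitmx.
  + by apply: scales_volume_block; rewrite ?oner_neq0//; exact: IH.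
  + exact: scales_volume_lshear1.
- by apply: scales_volume_block; rewrite ?oner_neq0 ?unitmx_inv//; apply: IH; rewrite unitmx_inv.
Qed.

(** Gaussian elimination: a matrix with nonzero corner entry is a lower shear times a block diagonal
    matrix times an upper shear, and the lower block falls to the induction hypothesis. *)
Lemma scales_volume_unitmx n (T : 'M[R]_n) : T \in unitmx -> scales_volume T.
Proof.
elim: n T => [|n IH] T uT.
  move=> K cK; rewrite [X in \det X]thinmx0 det_mx00 normr1 mul1e; congr volume.
  by apply/funext => v /=; congr K; rewrite [LHS]thinmx0 [RHS]thinmx0.
have lshear (u : 'cV[R]_n) :
    @scales_volume R n.+1 (block_mx 1%:M 0 u 1%:M : 'M[R]_(1 + n)).
  case: n IH {T uT} u => [|n] IH u; last exact: scales_volume_lshear.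
  rewrite [X in scales_volume X](_ : _ = 1%:M); first exact: scales_volume1.
  by rewrite [u]flatmx0 [RHS](@scalar_mx_block _ 1 0).
have pivot (S : 'M[R]_(1 + n)) : (S : 'M[R]_n.+1) \in unitmx -> S 0 0 != 0 ->
    @scales_volume R n.+1 S.
  move=> uS S0.
  set a := S 0 0 in S0; pose b := ursubmx S; pose c := dlsubmx S; pose D := drsubmx S.
  (* The Schur complement of the corner entry. *)
  pose E := D - a^-1 *: (c *m b).
  pose L := block_mx 1%:M 0 (a^-1 *: c) 1%:M : 'M[R]_(1 + n).
  pose M := block_mx a%:M 0 0 E : 'M[R]_(1 + n).
  pose U := block_mx 1%:M (a^-1 *: b) 0 1%:M : 'M[R]_(1 + n).
  have SE : S = L *m M *m U.
    rewrite /L /M /U !mulmx_block.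
    rewrite !(mulmx1, mul1mx, mulmx0, mul0mx, addr0, add0r).
    rewrite -[LHS]submxK; congr block_mx.
    - rewrite [LHS]mx11_scalar !mxE; congr (_ %:M); congr (S _ _); exact: val_inj.
    - by rewrite mul_scalar_mx scalerA mulfV// scale1r.
    - by rewrite mul_mx_scalar scalerA mulfV// scale1r.
    - rewrite mul_mx_scalar scalerA mulfV// scale1r -scalemxAr /E addrC subrK.
      by [].
  have uE : E \in unitmx.
    move: uS; rewrite SE !unitmx_mul => /andP[/andP[_ +] _].
    have dM : \det M = a * \det E by rewrite /M det_ublock det_scalar1.
    by rewrite !unitmxE [X in X \is a _](dM : _ = _) unitrM => /andP[].
  rewrite SE; apply: scales_volumeM.
  - exact: shear_unitmx.
  - apply: scales_volumeM; [exact: block_unitmx|exact: lshear|].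
    by apply: scales_volume_block => //; exact: IH.
  - exact: scales_volume_shear.
have [T0|T0] := eqVneq (T 0 0) 0; last exact: pivot.
case: n IH lshear pivot T uT T0 => [|n] IH lshear pivot T uT T0.
  by move: uT; rewrite [T]mx11_scalar T0 unitmxE det_scalar1 unitr0.
(* A lower shear makes the corner entry of [T] equal to |b|^2. *)
pose b := @ursubmx _ 1 n.+1 1 n.+1 T.
have b0 : b != 0.
  apply/eqP => /rowP b0.
  have d0 : (delta_mx 0 0 : 'rV[R]_n.+2) *m T = 0.
    apply/rowP => j; rewrite -rowE [LHS]mxE [RHS]mxE.
    case: (unliftP 0 j) => [l|] ->; last by rewrite T0.
    by have := b0 l; rewrite !mxE => <-; congr (T _ _); exact: val_inj.
  have /rowP/(_ 0) : (delta_mx 0 0 : 'rV[R]_n.+2) = 0.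
    by rewrite -[LHS](mulmxK uT) d0 mul0mx.
  by rewrite !mxE !eqxx => /eqP; rewrite oner_eq0.
pose L (u : 'cV[R]_n.+1) := block_mx 1%:M 0 u 1%:M : 'M[R]_(1 + n.+1).
have LN u : L u *m L (- u) = 1%:M.
  rewrite /L (@mulmx_block _ 1 n.+1 1 n.+1 1 n.+1).
  rewrite !(mulmx1, mul1mx, mulmx0, mul0mx, addr0, add0r) subrr.
  by rewrite -(@scalar_mx_block _ 1 n.+1).
rewrite -[T]mulmx1 -(LN b^T) mulmxA; apply: scales_volumeM.
- exact: lshear_unitmx.
- apply: pivot.
    by rewrite unitmx_mul uT; exact: lshear_unitmx.
  rewrite (_ : _ 0 0 = (b *m b^T) 0 0).
    apply: contra b0 => /eqP bb; apply/eqP/dotv_eq0.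
    by apply/matrixP => i j; rewrite !ord1 bb mxE.
  transitivity (@ulsubmx _ 1 n.+1 1 n.+1 (T *m L b^T) 0 0).
    by rewrite !mxE; apply: eq_bigr => l _; congr (T _ _ * L _ _ _); exact: val_inj.
  rewrite -{1}[T](@submxK _ 1 n.+1 1 n.+1) /L (@mulmx_block _ 1 n.+1 1 n.+1 1 n.+1).
  rewrite block_mxKul mulmx1 [LHS]mxE [X in X + _ = _](_ : _ = 0) ?add0r//.
  by rewrite !mxE -[RHS]T0; congr (T _ _); exact: val_inj.
- exact: lshear.
Qed.

End gl.

(** * Sum of a convex body and a segment *)

Section segment_sum.
Variable R : realType.
Local Notation mu := (@lebesgue_measure R).

Definition is_convex n (K : set 'rV[R]_n) := forall x y (t : R),
  K x -> K y -> 0 <= t <= 1 -> K (t *: x + (1 - t) *: y).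

Definition segment_sum n (K : set 'rV[R]_n) (u : 'rV[R]_n) (t : R) :=
  [set v | exists2 s : R, 0 <= s <= t & K (v - s *: u)].

Lemma compact_image_mulmx m n (K : set 'rV[R]_m) (T : 'M[R]_(m, n)) :
  compact K -> compact [set v *m T | v in K].
Proof.
move=> cK; apply: continuous_compact => //; apply: continuous_subspaceT.
exact: mulmxr_continuous.
Qed.

Lemma convex_image_mulmx m n (K : set 'rV[R]_m) (T : 'M[R]_(m, n)) :
  is_convex K -> is_convex [set v *m T | v in K].
Proof.
move=> cK _ _ t [x Kx <-] [y Ky <-] t01.
exists (t *: x + (1 - t) *: y); first exact: cK.
by rewrite mulmxDl -!scalemxAl.
Qed.

Lemma segment_sum_compact n (K : set 'rV[R]_n) u t : compact K ->
  compact (segment_sum K u t).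
Proof.
move=> cK.
have -> : segment_sum K u t =
    (fun p : 'rV[R]_n * R => p.1 + p.2 *: u) @` (K `*` `[0, t]%classic).
  apply/seteqP; split => [v [s st Kv]|_ [[v s] [/= Kv st] <-]].
    by exists (v - s *: u, s); rewrite /= ?subrK// in_itv.
  by exists s; [move: st; rewrite in_itv|rewrite addrK].
apply: continuous_compact; last first.
  by apply: compact_setX => //; exact: segment_compact.
apply: continuous_subspaceT; apply: mx_continuous => i j.
under [X in continuous X]eq_fun do rewrite 2!mxE.
move=> p; apply: cvgD.
  apply: (@cvg_comp _ _ _ fst (fun M : 'rV[R]_n => M i j)); first exact: cvg_fst.
  exact: coord_continuous.
by apply: cvgMl; exact: cvg_snd.
Qed.

Lemma segment_sum_convex n (K : set 'rV[R]_n) u t : is_convex K ->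
  is_convex (segment_sum K u t).
Proof.
move=> cK x y a [s st Kx] [r rt Ky] a01.
exists (a * s + (1 - a) * r).
  move: a01 st rt => /andP[? ?] /andP[? ?] /andP[? ?]; apply/andP; split; first nra.
  nra.
rewrite (_ : _ - _ = a *: (x - s *: u) + (1 - a) *: (y - r *: u)); first exact: cK.
by rewrite !scalerBr !scalerA (scalerDl u) opprD addrACA.
Qed.

Lemma col'_compact n (K : set 'rV[R]_n.+1) : compact K ->
  compact [set col' ord_max v | v in K].
Proof.
move=> cK; apply: continuous_compact => //; apply: continuous_subspaceT.
apply: mx_continuous => i j.
by under [X in continuous X]eq_fun do rewrite mxE; exact: coord_continuous.
Qed.

Lemma coord1_compact (K : set 'rV[R]_1) : compact K ->
  compact [set x | K x%:M].
Proof.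
move=> cK.
have -> : [set x | K x%:M] = (fun u : 'rV[R]_1 => u 0 0) @` K.
  apply/seteqP; split => [x Kx|_ [u Ku <-]/=].
    by exists x%:M => //; rewrite mxE eqxx mulr1n.
  by rewrite -mx11_scalar.
apply: continuous_compact => //; apply: continuous_subspaceT.
exact: coord_continuous.
Qed.

Lemma volume1E (K : set 'rV[R]_1) : compact K ->
  volume K = mu [set x | K x%:M].
Proof.
move=> cK; have xE (x : R) : (row_mx x%:M (0 : 'rV_0) : 'rV_1) = x%:M.
  by apply/rowP => i; rewrite ord1 row_mx_ord0 mxE eqxx mulr1n.
rewrite volumeS -[X in _ = mu X]setIT -integral_indic//.
  apply: eq_integral => x _; rewrite /= !indicE.
  have [Kx|Kx] := pselect (K x%:M).
    by rewrite !mem_set//= /section_at/= xE.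
  by rewrite !memNset//= /section_at/= xE.
by apply: compact_measurable; exact: coord1_compact.
Qed.

Lemma compact_convex1 (K : set 'rV[R]_1) : compact K -> is_convex K ->
  K !=set0 ->
  exists a b, a <= b /\ [set x | K x%:M] = `[a, b]%classic.
Proof.
move=> cK vK [u Ku]; have cI := coord1_compact cK.
have I0 : [set x | K x%:M] !=set0 by exists (u 0 0); rewrite /= -mx11_scalar.
have ci : {within [set x | K x%:M], continuous (@id R)}.
  by apply: continuous_subspaceT => x; exact: cvg_id.
have [b bI bmax] := compact_EVT_max I0 cI ci.
have [a aI amin] := compact_EVT_min I0 cI ci.
have ab : a <= b by exact: amin.
exists a, b; split => //; apply/seteqP; split => x /=.
  by move=> Kx; rewrite in_itv/= amin ?inE// bmax ?inE.
rewrite in_itv/= => /andP[ax xb]; rewrite !inE/= in aI bI.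
have [|ab'] := leP b a.
  by move=> ba; rewrite (_ : x = a)//; apply/eqP; rewrite eq_le ax (le_trans xb).
have := vK _ _ ((x - b) / (a - b)) aI bI; rewrite !scale_scalar_mx -raddfD/=.
rewrite [X in X%:M](_ : _ = x); last by field; lra.
apply; apply/andP; split.
  by rewrite ler_ndivlMr ?mul0r; lra.
by rewrite ler_ndivrMr ?mul1r; lra.
Qed.

Lemma row_mx_delta_last n (s x : R) (v : 'rV[R]_n.+1) :
  (row_mx x%:M v : 'rV_n.+2) - s *: delta_mx 0 ord_max =
  row_mx x%:M (v - s *: delta_mx 0 ord_max).
Proof.
apply/rowP => i; rewrite [LHS]mxE [X in _ + X = _]mxE [X in _ + - X = _]mxE [X in _ + - (_ * X) = _]mxE.
case: (unliftP 0 i) => [j|] ->.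
  have dE : (lift ord0 j == ord_max :> 'I_n.+2) = (j == ord_max).
    by rewrite -[LHS]val_eqE -[RHS]val_eqE.
  by rewrite !row_mx_lift0 !mxE eqxx /= dE.
by rewrite !row_mx_ord0 /= mulr0 subr0.
Qed.

Lemma col'_row_mx1 n (x : R) (v : 'rV[R]_n.+1) :
  col' ord_max (row_mx x%:M v : 'rV_n.+2) = row_mx x%:M (col' ord_max v) :> 'rV_n.+1.
Proof.
apply/rowP => i; rewrite [LHS]mxE.
case: (unliftP 0 i) => [j|] ->.
  rewrite row_mx_lift0 [RHS]mxE (_ : lift _ _ = lift ord0 (lift ord_max j)) ?row_mx_lift0//.
  by apply/val_inj; rewrite /= /bump /= ltnS addnCA.
rewrite row_mx_ord0 (_ : lift _ _ = 0) ?row_mx_ord0//.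
exact/val_inj.
Qed.

(** [volume] slices along the first coordinate, so the last basis vector stays parallel to the
    slices and the formula can be integrated slice by slice, down to dimension 1. There a nonempty
    compact convex set is an interval, which grows by [t], and its projection to R^0 has mass 1. *)
Lemma volume_segment_sum_last n (K : set 'rV[R]_n.+1) t :
  compact K -> is_convex K -> 0 <= t ->
  volume (segment_sum K (delta_mx 0 ord_max) t) =
  (volume K + t%:E * volume [set col' ord_max v | v in K])%E.
Proof.
elim: n K => [|n IH] K cK vK t0.
  have [->|/set0P K0] := eqVneq K set0.
    rewrite image_set0 !volume_set0 mule0 adde0 (_ : segment_sum _ _ _ = set0) ?volume_set0//.
    by apply/seteqP; split => // v [].
  have [a [b [ab Kab]]] := compact_convex1 cK vK K0.
  rewrite (_ : [set col' ord_max v | v in K] = setT); last first.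
    apply/seteqP; split => // v _; have [u Ku] := K0; exists u => //.
    by rewrite [LHS]thinmx0 [RHS]thinmx0.
  rewrite [X in (_ * X)%E](_ : _ = 1%E); last by rewrite /= indicE in_setT.
  rewrite mule1 !volume1E//; last exact: segment_sum_compact.
  rewrite Kab (_ : [set x | segment_sum _ _ _ _] = `[a, b + t]%classic).
    rewrite !lebesgue_measure_itv/= !lte_fin -!EFinD.
    have [ab'|ab'] := ltrP a b.
      by rewrite (lt_le_trans ab') ?lerDl// -EFinD; congr EFin; lra.
    have -> : b = a by lra.
    rewrite ltrDl; have [t0'|t0'] := ltrP 0 t.
      by rewrite add0e; congr EFin; lra.
    have -> : t = 0 by lra.
    by rewrite add0e.
  have sub x s : (x%:M - s *: delta_mx 0 ord_max : 'rV[R]_1) = (x - s)%:M.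
    by apply/rowP => i; rewrite [i]ord1 !mxE !eqxx /= mulr1 !mulr1n.
  apply/seteqP; split => x; rewrite /= in_itv/=.
    move=> [s /andP[s0 st]]; rewrite sub => Kxs.
    have : [set x | K x%:M] (x - s) by [].
    by rewrite Kab /= in_itv/= => /andP[? ?]; apply/andP; split; lra.
  have /seteqP[_ Kab'] := Kab => /andP[ax xb].
  have [bx|bx] := leP x b.
    by exists 0; rewrite ?lexx// sub subr0; apply: Kab'; rewrite /= in_itv/= ax.
  exists (x - b); first by apply/andP; split; lra.
  by rewrite sub; apply: Kab'; rewrite /= in_itv/=; apply/andP; split; lra.
have cK' := col'_compact cK.
have cS := @segment_sum_compact _ K (delta_mx 0 ord_max) t cK.
rewrite !volumeS -ge0_integralZl//; last 2 first.
- exact: (measurable_section_volume cK').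
- by move=> x _; exact: volume_ge0.
rewrite -ge0_integralD//; last 4 first.
- by move=> x _; exact: volume_ge0.
- exact: (measurable_section_volume cK).
- by move=> x _; rewrite mule_ge0 ?lee_fin ?volume_ge0.
- by apply: measurable_funeM; exact: (measurable_section_volume cK').
apply: eq_integral => x _.
have -> : section_at (segment_sum K (delta_mx 0 ord_max) t) x =
    segment_sum (section_at K x) (delta_mx 0 ord_max) t.
  by apply/seteqP; split => v [s st Kv]; exists s => //; move: Kv;
    by rewrite /section_at/= (row_mx_delta_last s x v).
rewrite IH//; [|exact: section_compact|]; last first.
  move=> a b s; rewrite /section_at /= => Ka Kb s01.
  have := vK _ _ s Ka Kb s01; congr K.
  rewrite (@scale_row_mx _ 1 1 n.+1) (@scale_row_mx _ 1 1 n.+1) (@add_row_mx _ 1 1 n.+1).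
  congr (@row_mx _ 1 1 n.+1 _ _).
  by rewrite -scalerDl addrC subrK scale1r.
congr (_ + _ * volume _)%E; apply/seteqP; split => [_ [v Kv <-]|w].
  by exists (row_mx x%:M v) => //; rewrite col'_row_mx1.
rewrite /section_at/= => -[u Ku]; rewrite [u]row_mx1_eta col'_row_mx1 => uw.
exists (\row_j u 0 (lift ord0 j)).
  rewrite /section_at/=; move: Ku; rewrite {1}[u]row_mx1_eta; congr (K (row_mx (_ %:M) _)).
  by have /rowP/(_ 0) := uw; rewrite !row_mx_ord0.
by apply/rowP => j; have /rowP/(_ (lift ord0 j)) := uw; rewrite !row_mx_lift0.
Qed.

End segment_sum.

(** * Inner products, reflections and corner updates of determinants *)

Section dot.
Variable R : realType.

Lemma mulmx_trE n (u v : 'rV[R]_n) : u *m v^T = (dot u v)%:M.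
Proof. by rewrite [LHS]mx11_scalar -dotE. Qed.

Lemma dotC n (u v : 'rV[R]_n) : dot u v = dot v u.
Proof. by apply: eq_bigr => i _; rewrite mulrC. Qed.

Lemma dotBl n (u v w : 'rV[R]_n) : dot (u - v) w = dot u w - dot v w.
Proof. by rewrite !dotE mulmxBl !mxE. Qed.

Lemma dotZl n a (u v : 'rV[R]_n) : dot (a *: u) v = a * dot u v.
Proof. by rewrite !dotE -scalemxAl !mxE. Qed.

Lemma dotZr n a (u v : 'rV[R]_n) : dot u (a *: v) = a * dot u v.
Proof. by rewrite dotC dotZl dotC. Qed.

Lemma dot_ge0 n (u : 'rV[R]_n) : 0 <= dot u u.
Proof. by apply: sumr_ge0 => i _; rewrite -expr2 sqr_ge0. Qed.

Lemma dot_eq0 n (u : 'rV[R]_n) : (dot u u == 0) = (u == 0).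
Proof.
apply/eqP/eqP => [d0|->]; last by rewrite dotE mul0mx mxE.
by apply: dotv_eq0; rewrite mulmx_trE d0 raddf0.
Qed.

Lemma dot_gt0 n (u : 'rV[R]_n) : (0 < dot u u) = (u != 0).
Proof. by rewrite lt_def dot_ge0 andbT dot_eq0. Qed.

Lemma dot_delta n i : dot (delta_mx 0 i : 'rV[R]_n) (delta_mx 0 i) = 1.
Proof.
rewrite /dot (bigD1 i)//= big1 => [|j ji]; rewrite !mxE !eqxx ?mulr1 ?addr0//.
by rewrite (negbTE ji) mulr0.
Qed.

Lemma enorm_sqr n (u : 'rV[R]_n) : enorm u ^+ 2 = dot u u.
Proof. by rewrite sqr_sqrtr// dot_ge0. Qed.

Lemma enorm_ge0 n (u : 'rV[R]_n) : 0 <= enorm u.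
Proof. exact: sqrtr_ge0. Qed.

Lemma orthogonal_maps_unit n (e u : 'rV[R]_n) : dot e e = 1 -> dot u u = 1 ->
  exists2 Q : 'M[R]_n, Q *m Q^T = 1%:M & e *m Q = u.
Proof.
move=> e1 u1; have [->|eu] := eqVneq e u.
  by exists 1%:M; rewrite ?trmx1 ?mulmx1.
pose w := u - e; pose k := 2 / dot w w.
have w0 : dot w w != 0 by rewrite dot_eq0 subr_eq0 eq_sym.
have ww : dot w w = 2 - 2 * dot e u.
  by rewrite /w dotBl ![dot _ (_ - _)]dotC !dotBl u1 e1 (dotC u e); ring.
have ew : dot e w = dot e u - 1 by rewrite dotC /w dotBl (dotC u e) e1.
(* the reflection exchanging [e] and [u] *)
exists (1%:M - k *: (w^T *m w)).
  set P := w^T *m w.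
  have PT : P^T = P by rewrite trmx_mul trmxK.
  have PP : P *m P = dot w w *: P.
    by rewrite mulmxA -(mulmxA _ w) mulmx_trE mul_mx_scalar -scalemxAl.
  have -> : (1%:M - k *: P)^T = 1%:M - k *: P.
    by rewrite [LHS]raddfB /= trmx1 linearZ /= PT.
  rewrite mulmxBl mul1mx mulmxBr mulmx1 -scalemxAl -scalemxAr PP !scalerA.
  rewrite -addrA -opprD -scalerBl -scalerDl [X in X *: P](_ : _ = 0) ?scale0r ?subr0//.
  by rewrite /k; field.
rewrite mulmxBr mulmx1 -scalemxAr mulmxA mulmx_trE mul_scalar_mx scalerA ew.
rewrite (_ : _ * _ = -1) ?scaleN1r ?opprK ?subrKC//; last first.
  by rewrite /k ww; field; rewrite -ww.
Qed.

Lemma orthogonal_unitmx n (Q : 'M[R]_n) : Q *m Q^T = 1%:M -> Q \in unitmx.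
Proof. by move=> /mulmx1_unit[]. Qed.

Lemma normr_det_orthogonal n (Q : 'M[R]_n) : Q *m Q^T = 1%:M -> `|\det Q| = 1.
Proof.
move=> /(congr1 determinant); rewrite det_mulmx det_tr det1 -expr2 => dQ.
by apply/eqP; rewrite -(@eqrXn2 _ 2)// -normrX dQ normr1 expr1n.
Qed.

(** Linearity of the determinant in the last row. [C] is [N] with its last row replaced by the last
    basis vector. *)
Lemma det_add_corner n (N : 'M[R]_n.+1) a :
  \det (N + a *: ((delta_mx 0 ord_max : 'rV_n.+1)^T *m delta_mx 0 ord_max)) =
  \det N + a * \det (row' ord_max (col' ord_max N)).
Proof.
pose C := \matrix_(i, j) (if i == ord_max then (j == ord_max)%:R else N i j).
have -> : row' ord_max (col' ord_max N) = row' ord_max (col' ord_max C).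
  by apply/matrixP => i j; rewrite !mxE eq_sym (negbTE (neq_lift _ _)).
have <- : \det C = \det (row' ord_max (col' ord_max C)).
  rewrite (expand_det_row _ ord_max) (bigD1 ord_max)//= big1 => [|j jn].
    by rewrite mxE !eqxx mul1r addr0 /cofactor addnn -signr_odd odd_double mul1r.
  by rewrite mxE eqxx (negbTE jn) mul0r.
rewrite trmx_delta mul_delta_mx; transitivity (1 * \det N + a * \det C);
  last by rewrite mul1r.
apply: (@determinant_multilinear _ _ _ _ _ ord_max).
- apply/rowP => j; rewrite !mxE eqxx /= eq_sym mul1r.
  by [].
- by apply/matrixP => i j; rewrite !mxE [_ == ord_max]eq_sym (negbTE (neq_lift _ _)) mulr0 addr0.
- by apply/matrixP => i j; rewrite !mxE [_ == ord_max]eq_sym (negbTE (neq_lift _ _)) mulr0 addr0.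
Qed.

End dot.

(** * Adding one generator, for the volume and for the determinant *)

Section step.
Variable R : realType.

Lemma volume_preimage_orthogonal n (K : set 'rV[R]_n) (Q : 'M[R]_n) :
  Q *m Q^T = 1%:M -> compact K -> volume [set v | K (v *m Q)] = volume K.
Proof.
move=> QQ cK; rewrite [RHS](scales_volume_unitmx (orthogonal_unitmx QQ))//.
by rewrite normr_det_orthogonal// mul1e.
Qed.

(** The rows of [V] form an orthonormal basis of the complement of [u]: they are those of an
    orthogonal matrix with last row u / |u|, without that row. One and the same [V] serves the
    volume and the determinant, so both obey the same recurrence. *)
Lemma segment_step n (u : 'rV[R]_n.+1) : u != 0 ->
  exists V : 'M[R]_(n, n.+1), [/\ V *m V^T = 1%:M,
    forall K t, compact K -> is_convex K -> 0 <= t ->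
      volume (segment_sum K u t) =
      (volume K + (t * enorm u)%:E * volume [set v *m V^T | v in K])%E &
    forall M c, \det (M + c *: (u^T *m u)) =
      \det M + c * dot u u * \det (V *m M *m V^T)].
Proof.
move=> u0; have nu : 0 < enorm u by rewrite sqrtr_gt0 dot_gt0.
pose e : 'rV[R]_n.+1 := delta_mx 0 ord_max.
have [Q QQ eQ] := @orthogonal_maps_unit R n.+1 e ((enorm u)^-1 *: u)
  (dot_delta _ _) ltac:(by rewrite dotZl dotZr mulrA -expr2 exprVn enorm_sqr mulVf// dot_eq0).
have QQ' : Q^T *m Q = 1%:M by exact: mulmx1C.
have uE : u = enorm u *: (e *m Q) by rewrite eQ scalerA divff ?scale1r// gt_eqF.
pose V := row' ord_max Q.
have VE m (A : 'M[R]_(m, n.+1)) : A *m V^T = col' ord_max (A *m Q^T).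
  by apply/matrixP => i j; rewrite !mxE; apply: eq_bigr => k _; rewrite !mxE.
have VE' m (A : 'M[R]_(n.+1, m)) : V *m A = row' ord_max (Q *m A).
  by apply/matrixP => i j; rewrite !mxE; apply: eq_bigr => k _; rewrite !mxE.
exists V; split.
- rewrite VE' VE QQ; apply/matrixP => i j; rewrite !mxE.
  by rewrite (inj_eq lift_inj).
- move=> K t cK vK t0; have uQ := orthogonal_unitmx QQ.
  have cK' := compact_preimage_mulmx uQ cK.
  rewrite -(volume_preimage_orthogonal QQ cK).
  rewrite -(volume_preimage_orthogonal QQ (@segment_sum_compact _ _ K u t cK)).
  rewrite [X in volume X](_ : _ = segment_sum [set v | K (v *m Q)] e (t * enorm u)); last first.
    apply/seteqP; split => w [s /andP[s0 st] Ks]; rewrite /segment_sum/=.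
      exists (s * enorm u); first by rewrite mulr_ge0 ?(ltW nu)//= ler_pM2r.
      by rewrite mulmxBl -scalemxAl -scalerA -uE.
    exists (s / enorm u).
      by rewrite divr_ge0 ?(ltW nu)//= ler_pdivrMr.
    by rewrite [X in _ *: X]uE scalerA divfK ?gt_eqF// scalemxAl -mulmxBl.
  rewrite volume_segment_sum_last//; last 2 first.
  + move=> x y a Kx Ky a01; rewrite /= mulmxDl -!scalemxAl; exact: vK.
  + by rewrite mulr_ge0// ltW.
  congr (_ + _ * volume _)%E; apply/seteqP; split => [_ [v Kv <-]|_ [v Kv <-]].
    by exists (v *m Q) => //; rewrite VE -mulmxA QQ mulmx1.
  exists (v *m Q^T); first by rewrite /= -mulmxA QQ' mulmx1.
  by rewrite VE.
- move=> M c.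
  have dQ : \det Q * \det Q = 1.
    by have := congr1 determinant QQ; rewrite det_mulmx det_tr det1.
  have dE A : \det A = \det (Q *m A *m Q^T).
    by rewrite !det_mulmx det_tr mulrAC dQ mul1r.
  rewrite (dE (M + _)) (dE M) mulmxDr mulmxDl.
  have -> : Q *m (c *: (u^T *m u)) *m Q^T = (c * dot u u) *: (e^T *m e).
    have uQ : u *m Q^T = enorm u *: e.
      by rewrite {1}uE -scalemxAl -mulmxA QQ mulmx1.
    have Qu : Q *m u^T = enorm u *: e^T.
      by rewrite -[LHS]trmxK trmx_mul trmxK uQ linearZ.
    rewrite -scalemxAr -scalemxAl mulmxA -(mulmxA _ u) uQ Qu.
    by rewrite -scalemxAl -scalemxAr !scalerA -mulrA -expr2 enorm_sqr.
  rewrite det_add_corner; congr (_ + _ * \det _).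
  by rewrite -[V *m M *m _]mulmxA VE' mulmxA VE.
Qed.

End step.

(** * Volume of zonotopes *)

Section zonotope_volume.
Variable R : realType.

(* The pair [(c, u)] stands for the segment [0, c u]. *)
Fixpoint zono n (s : seq (R * 'rV[R]_n)) : set 'rV[R]_n :=
  if s is p :: s' then segment_sum (zono s') p.2 p.1 else [set 0].

Definition gram n (s : seq (R * 'rV[R]_n)) : 'M[R]_n :=
  \sum_(p <- s) p.1 *: (p.2^T *m p.2).

Definition map_gens m n (T : 'M[R]_(m, n)) (s : seq (R * 'rV[R]_m)) :=
  [seq (p.1, p.2 *m T) | p <- s].

Definition weights n (s : seq (R * 'rV[R]_n)) : R := \sum_(p <- s) p.1.

Definition nonneg_weights n (s : seq (R * 'rV[R]_n)) := all (fun p => 0 <= p.1) s.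

Lemma zono_compact n (s : seq (R * 'rV[R]_n)) : compact (zono s).
Proof. by elim: s => [|p s IH]; [exact: compact_set1|exact: segment_sum_compact]. Qed.

Lemma zono_convex n (s : seq (R * 'rV[R]_n)) : is_convex (zono s).
Proof.
elim: s => [|p s IH]; last exact: segment_sum_convex.
by move=> x y a /= -> -> _; rewrite !scaler0 addr0.
Qed.

Lemma segment_sum_image m n (K : set 'rV[R]_m) u t (T : 'M[R]_(m, n)) :
  [set v *m T | v in segment_sum K u t] =
  segment_sum [set v *m T | v in K] (u *m T) t.
Proof.
apply/seteqP; split => [_ [v [s st Kv] <-]|w [s st [v Kv e]]].
  by exists s => //; exists (v - s *: u) => //; rewrite mulmxBl scalemxAl.
exists (v + s *: u); first by exists s => //; rewrite addrK.
by rewrite mulmxDl -scalemxAl e subrK.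
Qed.

Lemma zono_image m n (T : 'M[R]_(m, n)) (s : seq (R * 'rV[R]_m)) :
  [set v *m T | v in zono s] = zono (map_gens T s).
Proof.
elim: s => [|p s IH] /=; last by rewrite segment_sum_image IH.
by rewrite image_set1 mul0mx.
Qed.

Lemma gram_map m n (T : 'M[R]_(m, n)) (s : seq (R * 'rV[R]_m)) :
  gram (map_gens T s) = T^T *m gram s *m T.
Proof.
rewrite /gram big_map mulmx_sumr mulmx_suml; apply: eq_bigr => p _ /=.
by rewrite trmx_mul -scalemxAr -scalemxAl !mulmxA.
Qed.

Lemma weights_map m n (T : 'M[R]_(m, n)) (s : seq (R * 'rV[R]_m)) :
  weights (map_gens T s) = weights s.
Proof. by rewrite /weights big_map. Qed.

Lemma nonneg_weights_map m n (T : 'M[R]_(m, n)) (s : seq (R * 'rV[R]_m)) :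
  nonneg_weights (map_gens T s) = nonneg_weights s.
Proof. by rewrite /nonneg_weights all_map. Qed.

Lemma segment_sum0 n (K : set 'rV[R]_n) t : 0 <= t -> segment_sum K 0 t = K.
Proof.
move=> t0; apply/seteqP; split => [v [s _]|v Kv]; first by rewrite scaler0 subr0.
by exists 0; rewrite ?lexx//= scaler0 subr0.
Qed.

Definition rvolume n (K : set 'rV[R]_n) : R := fine (volume K).

Lemma rvolumeE n (K : set 'rV[R]_n) : compact K -> volume K = (rvolume K)%:E.
Proof. by move=> cK; rewrite fineK// volume_fin_num. Qed.

Lemma rvolume_ge0 n (K : set 'rV[R]_n) : 0 <= rvolume K.
Proof. by rewrite fine_ge0// volume_ge0. Qed.

Lemma rvolume_le n (A B : set 'rV[R]_n) : compact A -> compact B ->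
  A `<=` B -> rvolume A <= rvolume B.
Proof.
by move=> cA cB AB; rewrite -lee_fin -!rvolumeE//; exact: volume_compact_le.
Qed.

Lemma zono_step n (u : 'rV[R]_n.+1) : u != 0 ->
  exists V : 'M[R]_(n, n.+1), [/\ V *m V^T = 1%:M,
    forall s c, 0 <= c ->
      rvolume (zono ((c, u) :: s)) =
      rvolume (zono s) + c * enorm u * rvolume (zono (map_gens V^T s)) &
    forall s c, \det (gram ((c, u) :: s)) =
      \det (gram s) + c * dot u u * \det (gram (map_gens V^T s))].
Proof.
move=> u0; have [V [VV Vvol Vdet]] := segment_step u0.
exists V; split => // s c => [c0|].
  apply: EFin_inj; rewrite -rvolumeE; last exact: zono_compact.
  rewrite -[zono _]/(segment_sum (zono s) u c) Vvol ?zono_image//; [|exact: zono_compact|exact: zono_convex].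
  by rewrite !rvolumeE//; exact: zono_compact.
by rewrite /gram big_cons addrC Vdet -/(gram s) -/(gram _) gram_map trmxK.
Qed.

Lemma zono_cons0 n (s : seq (R * 'rV[R]_n)) c : 0 <= c ->
  zono ((c, 0) :: s) = zono s.
Proof. by move=> c0; rewrite /= segment_sum0. Qed.

Lemma gram_cons0 n (s : seq (R * 'rV[R]_n)) c : gram ((c, 0) :: s) = gram s.
Proof. by rewrite /gram big_cons mulmx0 scaler0 add0r. Qed.

Lemma rvolume_dim0 (K : set 'rV[R]_0) : K 0 -> rvolume K = 1.
Proof. by move=> K0; rewrite /rvolume /= indicE mem_set. Qed.

Lemma zono0 n (s : seq (R * 'rV[R]_n)) : nonneg_weights s -> zono s 0.
Proof.
elim: s => [|p s IH] //= /andP[p0 /IH s0].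
by exists 0; rewrite ?lexx// scale0r subr0.
Qed.

(** Doubling fixes the set but multiplies its volume by 2^(n+1). *)
Lemma rvolume_set1 n : rvolume [set 0 : 'rV[R]_n.+1] = 0.
Proof.
have u2 : (2%:M : 'M[R]_n.+1) \in unitmx.
  by rewrite unitmxE det_scalar unitrX// unitfE pnatr_eq0.
have cs : compact ([set 0] : set 'rV[R]_n.+1) by exact: (@zono_compact _ [::]).
have := scales_volume_unitmx u2 cs.
rewrite (_ : [set v | _] = [set 0]); last first.
  apply/seteqP; split => v /=; last by move=> ->; rewrite mul0mx.
  by rewrite mul_mx_scalar => /eqP; rewrite scaler_eq0 pnatr_eq0 => /eqP.
rewrite (rvolumeE cs) -EFinM det_scalar => -[].
rewrite ger0_norm ?exprn_ge0// => e.
have : rvolume [set 0 : 'rV[R]_n.+1] * (2 ^+ n.+1 - 1) = 0 by rewrite mulrBr mulr1 mulrC -e subrr.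
move=> /eqP; rewrite mulf_eq0 => /orP[/eqP//|]; rewrite subr_eq0 => /eqP e2.
have : 1 < 2 ^+ n.+1 :> R by rewrite exprn_egt1// ltr1n.
by rewrite e2 ltxx.
Qed.

Lemma dot_mulmxl m n (A : 'M[R]_(m, n)) (u : 'rV[R]_m) (v : 'rV[R]_n) :
  dot (u *m A) v = dot u (v *m A^T).
Proof. by rewrite !dotE trmx_mul trmxK mulmxA. Qed.

(** Pythagoras: [p] is the orthogonal projection of [u] on the row space of [V]. *)
Lemma dot_mulmx_tr m n (V : 'M[R]_(m, n)) (u : 'rV[R]_n) : V *m V^T = 1%:M ->
  dot (u *m V^T) (u *m V^T) <= dot u u.
Proof.
move=> VV; pose p := u *m V^T *m V.
have pu : dot p u = dot (u *m V^T) (u *m V^T) by rewrite /p dot_mulmxl.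
have pp : dot p p = dot (u *m V^T) (u *m V^T).
  by rewrite {1}/p dot_mulmxl /p -(mulmxA (u *m V^T)) VV mulmx1.
have := dot_ge0 (u - p); rewrite dotBl ![dot _ (_ - _)]dotC !dotBl.
by rewrite (dotC u p) pu pp; lra.
Qed.

(** In the recurrences of [zono_step] a generator contributes with factor c |u| to the volume and c
    |u|^2 to the determinant; |u| <= 1 compares them, and projecting preserves this bound. The outer
    induction is on the dimension, the inner one on the generators. *)
Lemma zono_volume_lower n (s : seq (R * 'rV[R]_n)) : nonneg_weights s ->
  all (fun p => dot p.2 p.2 <= 1) s ->
  0 <= \det (gram s) <= rvolume (zono s).
Proof.
elim: n s => [|n IHn] s.
  move=> s0 _; rewrite [gram s]flatmx0 det_mx00 rvolume_dim0 ?ler01 ?lexx//.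
  exact: zono0.
elim: s => [|[c u] s IHs] /=.
  by move=> _ _; rewrite /gram big_nil det0 lexx rvolume_ge0.
move=> /andP[/= c0 s0] /andP[/= u1 s1].
have /andP[d0 dv] := IHs s0 s1.
have [->|un0] := eqVneq u 0.
  by rewrite -/(zono ((c, 0) :: s)) zono_cons0// gram_cons0 d0.
have [V [VV Vvol Vdet]] := zono_step un0.
have /andP[e0 ev] : 0 <= \det (gram (map_gens V^T s)) <=
    rvolume (zono (map_gens V^T s)).
  apply: IHn; first by rewrite nonneg_weights_map.
  rewrite all_map; apply/allP => p ps /=; apply: le_trans (dot_mulmx_tr _ VV) _.
  exact: (allP s1).
rewrite -/(zono ((c, u) :: s)) Vvol// Vdet -enorm_sqr.
have eu1 : enorm u <= 1 by rewrite -(@expr_le1 _ 2)// ?enorm_ge0// enorm_sqr.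
apply/andP; split; first by rewrite addr_ge0// mulr_ge0// mulr_ge0// sqr_ge0.
apply: lerD => //.
apply: ler_pM => //; first by rewrite mulr_ge0 ?sqr_ge0.
by rewrite ler_wpM2l// expr2 ler_piMl ?enorm_ge0.
Qed.

(** Cauchy-Schwarz for the vectors (sqrt D, u sqrt (c E)) and (sqrt A, sqrt (c B)), with |V| <= sqrt
    (D A) and |W| <= sqrt (E B). *)
Lemma sqr_add_le (V W D E A B c u : R) : 0 <= D -> 0 <= E -> 0 <= A -> 0 <= B ->
  0 <= c -> V ^+ 2 <= D * A -> W ^+ 2 <= E * B ->
  (V + c * u * W) ^+ 2 <= (D + c * u ^+ 2 * E) * (A + c * B).
Proof.
move=> D0 E0 A0 B0 c0 VDA WEB.
pose X := c * D * B; pose Y := c * u ^+ 2 * E * A.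
have X0 : 0 <= X by rewrite /X mulr_ge0 ?mulr_ge0.
have Y0 : 0 <= Y by rewrite /Y mulr_ge0// mulr_ge0// mulr_ge0// sqr_ge0.
(* The square of V (c u W) is at most X Y, and 4 X Y <= (X + Y)^2. *)
have cross : 2 * V * (c * u * W) <= X + Y.
  have [h|h] := lerP (2 * V * (c * u * W)) 0; first by rewrite (le_trans h)// addr_ge0.
  rewrite -(@ler_pXn2r _ 2)// ?nnegrE ?addr_ge0 ?(ltW h)//.
  have XY : (V * (c * u * W)) ^+ 2 <= X * Y.
    have -> : (V * (c * u * W)) ^+ 2 = (c * u) ^+ 2 * (V ^+ 2 * W ^+ 2) by ring.
    have -> : X * Y = (c * u) ^+ 2 * ((D * A) * (E * B)) by rewrite /X /Y; ring.
    by apply: ler_wpM2l; [exact: sqr_ge0|apply: ler_pM; rewrite ?sqr_ge0].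
  have := sqr_ge0 (X - Y); have : 4 * (V * (c * u * W)) ^+ 2 <= 4 * (X * Y) by lra.
  by rewrite -[2 * V * _]mulrA exprMn; nra.
have cu : (c * u * W) ^+ 2 <= (c * u ^+ 2 * E) * (c * B).
  have -> : (c * u * W) ^+ 2 = (c * u) ^+ 2 * W ^+ 2 by ring.
  have -> : (c * u ^+ 2 * E) * (c * B) = (c * u) ^+ 2 * (E * B) by ring.
  by apply: ler_wpM2l => //; exact: sqr_ge0.
rewrite sqrrD mulrDl !mulrDr -mulr_natl.
rewrite /X /Y in cross; lra.
Qed.

Lemma exprD_ge (S c : R) n : 0 <= S -> 0 <= c ->
  S ^+ n.+1 + n.+1%:R * c * S ^+ n <= (S + c) ^+ n.+1.
Proof.
move=> S0 c0; elim: n => [|n IH]; first by rewrite expr0 !expr1 mulr1 mul1r.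
rewrite (exprS (S + c) n.+1); apply: (le_trans _ (ler_wpM2l (addr_ge0 S0 c0) IH)).
have : 0 <= n.+1%:R * c ^+ 2 * S ^+ n.
  by apply: mulr_ge0; rewrite ?exprn_ge0// mulr_ge0// sqr_ge0.
rewrite -[n.+2%:R]natr1 (exprS S n.+1) (exprS S n); lra.
Qed.

Lemma weights_ge0 n (s : seq (R * 'rV[R]_n)) : nonneg_weights s -> 0 <= weights s.
Proof.
move=> /allP s0; rewrite /weights big_seq; apply: sumr_ge0 => p; exact: s0.
Qed.

(** [sqr_add_le] combines the bound for the remaining generators with the bound for their
    projections, one dimension lower. The factors S^k / k! are adapted to this, S being the sum of
    the weights: S^k / k! + c S^(k-1) / (k-1)! consists of two terms of the expansion of (S + c)^k /
    k!. *)
Lemma zono_volume_upper n (s : seq (R * 'rV[R]_n)) : nonneg_weights s ->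
  0 <= \det (gram s) /\
  rvolume (zono s) ^+ 2 <= \det (gram s) * (weights s ^+ n / n`!%:R).
Proof.
elim: n s => [|n IHn] s.
  move=> s0; rewrite [gram s]flatmx0 det_mx00 rvolume_dim0 ?ler01 ?lexx//.
    by rewrite expr0 fact0 divr1 mul1r expr1n lexx.
  exact: zono0.
elim: s => [|[c u] s IHs] /=.
  by move=> _; rewrite /gram big_nil det0 lexx rvolume_set1 expr0n mul0r.
move=> /andP[/= c0 s0].
have [d0 dv] := IHs s0.
have S0 := weights_ge0 s0.
have wE : weights ((c, u) :: s) = weights s + c.
  by rewrite /weights big_cons addrC.
rewrite -/(zono ((c, u) :: s)) wE.
have AB : weights s ^+ n.+1 / (n.+1)`!%:R + c * (weights s ^+ n / n`!%:R) <=
    (weights s + c) ^+ n.+1 / (n.+1)`!%:R.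
  apply: (le_trans _ (ler_wpM2r _ (exprD_ge n S0 c0))); last by rewrite invr_ge0.
  rewrite mulrDl lerD2l factS natrM le_eqVlt; apply/orP; left; apply/eqP.
  have cancel (N f x y : R) : N != 0 -> f != 0 -> N * x * y / (N * f) = x * (y / f).
    by move=> N0 f0; field; rewrite N0 f0.
  by rewrite cancel ?pnatr_eq0 -?lt0n ?fact_gt0.
have A0 : 0 <= weights s ^+ n.+1 / (n.+1)`!%:R by rewrite divr_ge0// exprn_ge0.
have B0 : 0 <= weights s ^+ n / n`!%:R by rewrite divr_ge0// exprn_ge0.
have [->|un0] := eqVneq u 0.
  rewrite zono_cons0// gram_cons0; split => //.
  apply: (le_trans dv); apply: ler_wpM2l => //.
  by apply: le_trans AB; rewrite lerDl mulr_ge0.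
have [V [VV Vvol Vdet]] := zono_step un0.
have [e0 ev] := IHn (map_gens V^T s) ltac:(by rewrite nonneg_weights_map).
rewrite Vvol// Vdet -enorm_sqr; split.
  by rewrite addr_ge0// mulr_ge0// mulr_ge0// sqr_ge0.
apply: (@le_trans _ _ ((\det (gram s) + c * enorm u ^+ 2 * \det (gram (map_gens V^T s))) *
    (weights s ^+ n.+1 / (n.+1)`!%:R + c * (weights s ^+ n / n`!%:R)))).
  by apply: sqr_add_le => //; rewrite -(weights_map V^T).
by apply: ler_wpM2l => //; rewrite addr_ge0// mulr_ge0// mulr_ge0// sqr_ge0.
Qed.

End zonotope_volume.

(** * Diagonalization of symmetric matrices *)

Section spectral.
Variable R : realType.

Lemma dot_continuous (T : topologicalType) n (f g : T -> 'rV[R]_n) :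
  continuous f -> continuous g -> continuous (fun x => dot (f x) (g x)).
Proof.
move=> /mx_continuousP fc /mx_continuousP gc; apply: sum_continuous => i x.
by apply: continuousM; [exact: fc|exact: gc].
Qed.

Lemma enorm_continuous (T : topologicalType) n (f : T -> 'rV[R]_n) :
  continuous f -> continuous (fun x => enorm (f x)).
Proof.
move=> fc x; apply: (@continuous_comp _ _ _ (fun x => dot (f x) (f x)) Num.sqrt).
  exact: dot_continuous.
exact: sqrt_continuous.
Qed.

Lemma det_continuous n : continuous (fun A : 'M[R]_n => \det A).
Proof.
apply: sum_continuous => s A.
apply: (@continuousM _ _ (cst ((-1) ^+ s))); first exact: cst_continuous.
apply: (@prod_continuous _ _ _ _ _ (fun i (A : 'M[R]_n) => A i (s i))).
by move=> i; exact: coord_continuous.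
Qed.

Lemma coord_le_enorm n (u : 'rV[R]_n) i : `|u 0 i| <= enorm u.
Proof.
rewrite -sqrtr_sqr ler_sqrt ?dot_ge0// /dot (bigD1 i)//= -expr2 lerDl.
by apply: sumr_ge0 => j _; rewrite -expr2 sqr_ge0.
Qed.

Lemma bounded_closed_compact_mx m n (A : set 'M[R]_(m, n)) (r : R) :
  (forall M i j, A M -> `|M i j| <= r) -> closed A -> compact A.
Proof.
move=> Ar cA.
have -> : A = (fun v : 'rV[R]_(m * n) => vec_mx v) @` [set v | A (vec_mx v)].
  apply/seteqP; split => [M AM|_ [v Av <-]//].
  by exists (mxvec M); rewrite /= mxvecK.
have vc : continuous (fun v : 'rV[R]_(m * n) => vec_mx v).
  apply: mx_continuous => i j.
  by under [X in continuous X]eq_fun do rewrite mxE; exact: coord_continuous.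
apply: continuous_compact; first exact: continuous_subspaceT.
apply: bounded_closed_compact; last exact: closed_comp.
exists `|r|; split => // y ry v /= Av; apply/mx_norm_leP.
  by rewrite (le_trans _ (ltW ry)).
move=> i j; rewrite ord1 -[v]vec_mxK; case/mxvec_indexP: j => a b.
by rewrite mxvecE (le_trans (Ar _ _ _ Av))// (le_trans (ler_norm _))// ltW.
Qed.

Lemma dotDl n (u v w : 'rV[R]_n) : dot (u + v) w = dot u w + dot v w.
Proof. by rewrite !dotE mulmxDl !mxE. Qed.

Lemma dotDr n (u v w : 'rV[R]_n) : dot u (v + w) = dot u v + dot u w.
Proof. by rewrite dotC dotDl !(dotC u). Qed.

(** A maximizer of the quadratic form [f] on the unit sphere is an eigenvector, with eigenvalue the
    maximum. Otherwise moving it in the direction of the residue [y] would raise the Rayleigh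
    quotient. *)
Lemma symmetric_eigenvector n (M : 'M[R]_n.+1) : M^T = M ->
  exists x l, dot x x = 1 /\ x *m M = l *: x.
Proof.
move=> MT; pose f (x : 'rV[R]_n.+1) := dot (x *m M) x.
have fc : continuous f.
  by apply: dot_continuous; [exact: mulmxr_continuous|move=> x; exact: cvg_id].
pose S := [set x : 'rV[R]_n.+1 | dot x x = 1].
have cS : compact S.
  apply: (@bounded_closed_compact_mx _ _ _ 1).
    move=> x i j /= Sx; rewrite ord1 (le_trans (coord_le_enorm _ _))//.
    by rewrite /enorm Sx sqrtr1.
  apply: (@closed_comp _ _ (fun x : 'rV[R]_n.+1 => dot x x) [set r | r = 1]); last exact: closed_eq.
  by move=> x _; apply: dot_continuous => y; exact: cvg_id.
have [x] := compact_EVT_max (ex_intro _ _ (@dot_delta R n.+1 0) : S !=set0) cS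
  (continuous_subspaceT fc).
rewrite inE => /= Sx xmax; exists x, (f x); split => //.
have g0 y : 0 <= f x * dot y y - f y.
  have [->|y0] := eqVneq y 0.
    have d0 : dot (0 : 'rV[R]_n.+1) 0 = 0 by apply/eqP; rewrite dot_eq0.
    by rewrite {2}/f mul0mx d0 mulr0 subr0.
  have ny : 0 < enorm y by rewrite sqrtr_gt0 dot_gt0.
  have := xmax ((enorm y)^-1 *: y); rewrite inE /S /= /f -scalemxAl !dotZl !dotZr.
  rewrite !mulrA -expr2 exprVn enorm_sqr mulVf ?dot_eq0// => /(_ erefl).
  by rewrite mulrC ler_pdivrMr ?dot_gt0// subr_ge0.
have MC u v : dot (u *m M) v = dot (v *m M) u by rewrite dot_mulmxl MT dotC.
apply/eqP; rewrite -subr_eq0 -dot_eq0.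
have [y yE] : exists y, y = x *m M - f x *: x by exists (x *m M - f x *: x).
rewrite -yE.
have key t : 0 <= t ^+ 2 * (f x * dot y y - f y) - 2 * t * dot y y.
  have xMy : dot (x *m M) y = dot y y + f x * dot x y.
    by rewrite -dotZl -dotDl yE subrK.
  have fD : f (x + t *: y) = f x + 2 * t * dot (x *m M) y + t ^+ 2 * f y.
    by rewrite /f mulmxDl -scalemxAl dotDl !dotDr !(dotZl, dotZr) (MC y x); ring.
  have dD : dot (x + t *: y) (x + t *: y) = 1 + 2 * t * dot x y + t ^+ 2 * dot y y.
    by rewrite dotDl !dotDr !(dotZl, dotZr) Sx (dotC y x); ring.
  by have := g0 (x + t *: y); rewrite fD dD xMy; lra.
rewrite eq_le dot_ge0 andbT leNgt; apply/negP => D0.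
have G0 := g0 y; set G := f x * _ - _ in key G0; set D := dot y y in key D0.
have G1 : 0 < G + 1 by rewrite ltr_wpDl.
have G1' : G + 1 != 0 by rewrite gt_eqF.
(* A small positive t makes the linear term of [key] win. For this one, D = t (G + 1) turns the
   right side into - t^2 (G + 2) < 0. *)
have := key (D / (G + 1)).
have -> : (D / (G + 1)) ^+ 2 * G - 2 * (D / (G + 1)) * D =
    - ((D / (G + 1)) ^+ 2 * (G + 2)) by field.
rewrite oppr_ge0 leNgt => /negP; apply.
by rewrite mulr_gt0 ?exprn_gt0 ?divr_gt0//; lra.
Qed.

(** Deflation: in an orthonormal basis that starts with an eigenvector, [M] splits by symmetry into
    its eigenvalue and a smaller symmetric block. *)
Lemma symmetric_diagonalizable n (M : 'M[R]_n) : M^T = M ->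
  exists W (l : 'rV[R]_n), W *m W^T = 1%:M /\ W *m M *m W^T = diag_mx l.
Proof.
elim: n M => [|n IH] M MT.
  by exists 1%:M, 0; split; rewrite [LHS]flatmx0 [RHS]flatmx0.
have [x [a [x1 xM]]] := symmetric_eigenvector MT.
have [Q QQ eQ] := orthogonal_maps_unit (@dot_delta R n.+1 0) x1.
have xQ : x *m Q^T = delta_mx 0 0 by rewrite -eQ -mulmxA QQ mulmx1.
have [N NE] : exists N : 'M[R]_(1 + n), N = Q *m M *m Q^T by exists (Q *m M *m Q^T).
have NT : N^T = N by rewrite NE !trmx_mul trmxK MT mulmxA.
have eN : (delta_mx 0 0 : 'rV[R]_n.+1) *m N = a *: delta_mx 0 0.
  by rewrite NE !mulmxA eQ xM -scalemxAl xQ.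
have [W [l [WW Wl]]] := IH (drsubmx N) ltac:(by rewrite trmx_drsub NT).
pose W1 := block_mx 1%:M 0 0 W : 'M[R]_(1 + n).
exists (W1 *m Q), (row_mx a%:M l : 'rV[R]_(1 + n)); split.
  rewrite trmx_mul mulmxA -(mulmxA W1) QQ mulmx1 /W1 (@tr_block_mx _ 1 n 1 n).
  rewrite (@mulmx_block _ 1 n 1 n 1 n) !trmx0 trmx1.
  rewrite !(mulmx1, mul1mx, mulmx0, mul0mx, addr0, add0r) WW.
  by rewrite -(@scalar_mx_block _ 1 n).
rewrite trmx_mul !mulmxA -(mulmxA W1) -(mulmxA W1) -NE.
have -> : N = block_mx a%:M 0 0 (drsubmx N).
  have N0 (j : 'I_(1 + n)) : N 0 j = a * (j == 0)%:R.
    have /rowP/(_ j) := eN; rewrite -rowE mxE => ->; rewrite !mxE eqxx.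
    by rewrite eq_sym.
  have l0 : @lshift 1 n 0 = 0 by exact: val_inj.
  have ur : ursubmx N = 0.
    apply/rowP => j; rewrite [RHS]mxE; transitivity (N 0 (rshift 1 j)).
      by rewrite !mxE; congr (N _ _); exact: val_inj.
    by rewrite N0 mulr0.
  rewrite -[LHS]submxK ur; congr block_mx.
    by rewrite [LHS]mx11_scalar !mxE l0 N0 eqxx mulr1.
  by rewrite -[LHS]trmxK trmx_dlsub NT ur trmx0.
rewrite /W1 (@tr_block_mx _ 1 n 1 n) !(@mulmx_block _ 1 n 1 n 1 n) !trmx0 trmx1.
rewrite !(mulmx1, mul1mx, mulmx0, mul0mx, addr0, add0r) Wl.
rewrite [RHS](@diag_mx_row _ n 1) (_ : diag_mx a%:M = a%:M)//.
by apply/matrixP => i j; rewrite !ord1 !mxE eqxx.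
Qed.

End spectral.

(** * The inequality for zonotopes *)

Section zonotope_theorem.
Variable R : realType.

Definition unit_gens n (s : seq 'rV[R]_n) : seq (R * 'rV[R]_n) := [seq (1, a) | a <- s].

Definition coord_rows n (W : 'M[R]_n) (A : {set 'I_n}) : 'M[R]_(#|A|, n) :=
  \matrix_(i, j) W (enum_val i) j.

(** The volume of the projection of [Z] on the span of the rows of [W] indexed by [A], in the
    coordinates of these rows when [W] is orthogonal. *)
Definition shadow n (W : 'M[R]_n) (Z : set 'rV[R]_n) (A : {set 'I_n}) : R :=
  rvolume [set z *m (coord_rows W A)^T | z in Z].

Definition bound_const n m (sigma : 'I_m -> {set 'I_n}) : R :=
  Num.sqrt n%:R ^+ n / \prod_(i < m) Num.sqrt ((#|sigma i|)`!)%:R.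

Lemma prod_uniform_cover n m (sigma : 'I_m -> {set 'I_n}) (l : 'I_n -> R) :
  uniform_cover 1 sigma -> \prod_(i < m) \prod_(j in sigma i) l j = \prod_j l j.
Proof.
move=> [_ s1]; rewrite (exchange_big_dep predT)//=; apply: eq_bigr => j _.
by rewrite prodr_const s1 expr1.
Qed.

(* For the [B] of [maximal_det], the weights are the Lewis weights of [s]. As 1 / 0 = 0, a zero
   generator yields the pair [(0, 0)]. *)
Definition weighted_gens n (B : 'M[R]_n) (s : seq 'rV[R]_n) : seq (R * 'rV[R]_n) :=
  [seq (enorm (a *m B), (enorm (a *m B))^-1 *: a) | a <- s].

Lemma weighted_gens_nonneg n (B : 'M[R]_n) s : nonneg_weights (weighted_gens B s).
Proof. by rewrite /nonneg_weights all_map; apply/allP => a _ /=; exact: enorm_ge0. Qed.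

Lemma enorm_eq0 n (u : 'rV[R]_n) : (enorm u == 0) = (u == 0).
Proof. by rewrite -dot_eq0 -enorm_sqr sqrf_eq0. Qed.

Lemma enorm_unit_eq0 n (B : 'M[R]_n) (a : 'rV[R]_n) : B \in unitmx ->
  (enorm (a *m B) == 0) = (a == 0).
Proof.
move=> uB; rewrite enorm_eq0; apply/eqP/eqP => [aB|->]; last by rewrite mul0mx.
by rewrite -[a](mulmxK uB) aB mul0mx.
Qed.

Lemma segment_sum_scale n (K : set 'rV[R]_n) (t : R) a : 0 < t ->
  segment_sum K (t^-1 *: a) t = segment_sum K a 1.
Proof.
move=> t0; apply/seteqP; split => v [r /andP[r0 rt] Kv].
  exists (r / t); last by rewrite -scalerA.
  by rewrite divr_ge0 ?(ltW t0)//= ler_pdivrMr ?mul1r.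
exists (r * t).
  by rewrite mulr_ge0 ?(ltW t0)//= ler_piMl// ltW.
by rewrite scalerA mulfK// gt_eqF.
Qed.

(** The pairs (1, a) and (c, a / c) stand for the same segment. Invertibility of [B] ensures that c
    vanishes only with a. *)
Lemma zono_weighted_gens n (B : 'M[R]_n) s : B \in unitmx ->
  zono (weighted_gens B s) = zono (unit_gens s).
Proof.
move=> uB; elim: s => [|a s IH]//=; rewrite IH.
have [->|a0] := eqVneq a 0.
  by rewrite scaler0 !segment_sum0 ?ler01 ?enorm_ge0.
by rewrite segment_sum_scale// lt_def enorm_ge0 enorm_unit_eq0// a0.
Qed.

Lemma gram_weighted_gens n (B : 'M[R]_n) s :
  gram (weighted_gens B s) = \sum_(a <- s) (enorm (a *m B))^-1 *: (a^T *m a).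
Proof.
rewrite /gram big_map; apply: eq_bigr => a _ /=.
rewrite [X in _ *: (X *m _)]linearZ /= -scalemxAl -scalemxAr !scalerA; congr (_ *: _).
have [->|c0] := eqVneq (enorm (a *m B)) 0; first by rewrite invr0 !mul0r.
by rewrite mulfV// mul1r.
Qed.

Lemma weights_weighted_gens n (B : 'M[R]_n) s :
  weights (weighted_gens B s) = \sum_(a <- s) enorm (a *m B).
Proof. by rewrite /weights big_map. Qed.

(** The generators [eta *: delta_mx 0 j] bound the entries of an admissible matrix by 1 / eta, so a
    maximum exists. It is invertible because the small multiple [t *: 1%:M] of the identity is
    admissible and has positive determinant. *)
Lemma maximal_det n (s : seq 'rV[R]_n) (eta : R) : 0 < eta ->
  (forall j, eta *: delta_mx 0 j \in s) ->
  exists B : 'M[R]_n, [/\ B \in unitmx, \sum_(a <- s) enorm (a *m B) <= 1 &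
    forall C : 'M[R]_n, \sum_(a <- s) enorm (a *m C) <= 1 ->
      \det C ^+ 2 <= \det B ^+ 2].
Proof.
move=> e0 es; pose F (B : 'M[R]_n) := \sum_(a <- s) enorm (a *m B).
have FZ t B : 0 <= t -> F (t *: B) = t * F B.
  move=> t0; rewrite /F mulr_sumr; apply: eq_bigr => a _.
  by rewrite -scalemxAr /enorm dotZl dotZr mulrA -expr2 sqrtrM ?sqr_ge0// sqrtr_sqr ger0_norm.
have F0 B : 0 <= F B by apply: sumr_ge0 => a _; exact: enorm_ge0.
have Fc : continuous F.
  apply: sum_continuous => a; apply: enorm_continuous.
  by apply: mulmx_continuous => x; [exact: cst_continuous|exact: cvg_id].
pose S := [set B | F B <= 1].
have cS : compact S.
  apply: (@bounded_closed_compact_mx _ _ _ _ eta^-1).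
    move=> B i j /= SB.
    have : enorm ((eta *: delta_mx 0 i) *m B) <= 1.
      by apply: le_trans SB; rewrite /F (big_rem _ (es i))/= lerDl sumr_ge0// => a _; exact: enorm_ge0.
    move=> /(le_trans (coord_le_enorm _ j)).
    rewrite -scalemxAl -rowE 2!mxE normrM (gtr0_norm e0) => h.
    by rewrite -[leRHS]mul1r ler_pdivlMr// mulrC.
  exact: (@closed_comp _ _ F [set r | r <= 1] (fun x _ => Fc x) (@closed_le _ _)).
pose t := (F 1%:M + 1)^-1.
have t0 : 0 < t by rewrite invr_gt0 ltr_wpDl.
have St : S (t *: 1%:M).
  have F1 : 0 < F 1%:M + 1 by rewrite ltr_wpDl.
  change (F (t *: 1%:M) <= 1); rewrite (FZ _ _ (ltW t0)) [t * _]mulrC /t.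
  by rewrite ler_pdivrMr// mul1r lerDl.
have detc : {within S, continuous (fun B : 'M[R]_n => \det B ^+ 2)}.
  apply: continuous_subspaceT; under [X in continuous X]eq_fun do rewrite expr2.
  by move=> B; apply: continuousM; exact: det_continuous.
have [B] := compact_EVT_max (ex_intro _ _ St : S !=set0) cS detc.
rewrite inE => SB Bmax; exists B; split => //; last first.
  by move=> C SC; apply: Bmax; rewrite inE.
have := Bmax (t *: 1%:M); rewrite inE => /(_ St).
rewrite scalemx1 det_scalar unitmxE unitfE => h.
rewrite -sqrf_eq0 gt_eqF//; apply: (lt_le_trans _ h).
by rewrite !exprn_gt0.
Qed.

Theorem zonotope_shadows n (s : seq 'rV[R]_n) (eta : R) : 0 < eta ->
  (forall j, eta *: delta_mx 0 j \in s) ->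
  exists2 W : 'M[R]_n, W *m W^T = 1%:M &
    forall m (sigma : 'I_m -> {set 'I_n}), uniform_cover 1 sigma ->
      \prod_(i < m) shadow W (zono (unit_gens s)) (sigma i) <=
      bound_const sigma * rvolume (zono (unit_gens s)).
Proof.
move=> e0 es; have [B [uB FB Bmax]] := maximal_det e0 es.
set g := weighted_gens B s; have g0 : nonneg_weights g := weighted_gens_nonneg B s.
rewrite -(zono_weighted_gens s uB) -/g.
have ME := gram_weighted_gens B s.
set M := gram g in ME.
have MT : M^T = M.
  rewrite ME linear_sum; apply: eq_bigr => a _.
  by rewrite linearZ /= trmx_mul trmxK.
have [W [l [WW Wl]]] := symmetric_diagonalizable MT.
have WW' : W^T *m W = 1%:M by exact: mulmx1C.
have WE a j : (a *m W^T) 0 j = dot a (row j W).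
  by rewrite mxE; apply: eq_bigr => k _; rewrite !mxE.
have lE j : l 0 j = \sum_(a <- s) (enorm (a *m B))^-1 * dot a (row j W) ^+ 2.
  transitivity ((W *m M *m W^T) j j); first by rewrite Wl mxE eqxx mulr1n.
  rewrite ME mulmx_sumr mulmx_suml summxE; apply: eq_bigr => a _.
  rewrite -scalemxAr -scalemxAl mxE; congr (_ * _).
  have -> : W *m (a^T *m a) *m W^T = (a *m W^T)^T *m (a *m W^T).
    by rewrite trmx_mul trmxK !mulmxA.
  by rewrite mxE big_ord1 [X in X * _]mxE !WE expr2.
(* Row j of [W] has a nonzero coordinate k, so the generator [eta *: delta_mx 0 k] contributes a
   positive term. *)
have l0 j : 0 < l 0 j.
  have : row j W != 0.
    rewrite -dot_eq0 (_ : dot _ _ = 1) ?oner_eq0//.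
    have /matrixP/(_ j j) := WW; rewrite !mxE eqxx mulr1n => WWj; apply: etrans WWj.
    by apply: eq_bigr => k _; rewrite !mxE.
  move=> /rV0Pn[k]; rewrite mxE => Wjk.
  rewrite lE (big_rem _ (es k))/=; apply: ltr_pwDl; last first.
    by apply: sumr_ge0 => a _; rewrite mulr_ge0 ?sqr_ge0// invr_ge0 enorm_ge0.
  have ek0 : eta *: delta_mx 0 k != 0 :> 'rV[R]_n.
    by rewrite scaler_eq0 gt_eqF//= -dot_eq0 dot_delta oner_eq0.
  rewrite mulr_gt0//.
    by rewrite invr_gt0 lt_def enorm_ge0 enorm_unit_eq0// ek0.
  rewrite exprn_even_gt0//= dotZl mulf_neq0 ?(gt_eqF e0)//.
  by rewrite -WE -rowE !mxE.
have detW : \det W ^+ 2 = 1.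
  by have := congr1 determinant WW; rewrite det_mulmx det_tr det1 expr2.
have detM : \det M = \prod_j l 0 j.
  have := congr1 determinant Wl.
  by rewrite det_diag !det_mulmx det_tr mulrAC -expr2 detW mul1r.
have detM0 : 0 < \det M by rewrite detM; apply: prodr_gt0 => ? _; exact: l0.
have detB0 : 0 < `|\det B| by rewrite normr_gt0 -unitfE -unitmxE.
(* The vectors a B / |a B| have norm 1, or 0 when a = 0, so the lower bound holds for the image
   under [B]: det (B^T M B) <= |det B| |Z|. One factor |det B| cancels. *)
have lower : `|\det B| * \det M <= rvolume (zono g).
  have /zono_volume_lower low : nonneg_weights (map_gens B g).
    by rewrite nonneg_weights_map.
  have /low/andP[_] : all (fun p => dot p.2 p.2 <= 1) (map_gens B g).
    rewrite !all_map; apply/allP => a _ /=.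
    rewrite -scalemxAl dotZl dotZr mulrA -expr2 -enorm_sqr -exprMn.
    have [->|c0] := eqVneq (enorm (a *m B)) 0; first by rewrite mulr0 expr0n ler01.
    by rewrite mulVf// expr1n.
  have img : rvolume [set v *m B | v in zono g] = `|\det B| * rvolume (zono g).
    apply: EFin_inj; rewrite EFinM -!rvolumeE; last 2 first.
    - exact: zono_compact.
    - by apply: compact_image_mulmx; exact: zono_compact.
    rewrite (scales_volume_unitmx uB); last first.
      by apply: compact_image_mulmx; exact: zono_compact.
    congr (_ * volume _)%E; apply/seteqP; split => [v [w gw /(can_inj (mulmxK uB)) <-]//|v gv].
    by exists v.
  rewrite gram_map !det_mulmx det_tr -zono_image img => h.
  rewrite -(ler_pM2l detB0); apply: le_trans h.
  by rewrite mulrA -normrM -expr2 ger0_norm ?sqr_ge0// expr2 mulrAC.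
have optimal : (\det M)^-1 <= n%:R ^+ n * \det B ^+ 2.
  (* C is [W^T *m diag_mx d]: scaling the j-th eigendirection by (n l_j)^(-1/2) gives C^T M C =
     1/n. *)
  pose d : 'rV[R]_n := \row_j (Num.sqrt (l 0 j * n%:R))^-1.
  have n0 (j : 'I_n) : 0 < n%:R :> R by rewrite ltr0n (leq_trans _ (ltn_ord j)).
  have dE j : d 0 j ^+ 2 = (l 0 j * n%:R)^-1.
    by rewrite mxE exprVn sqr_sqrtr// mulr_ge0// ltW.
  have aC a j : (a *m (W^T *m diag_mx d)) 0 j = dot a (row j W) * d 0 j.
    by rewrite mulmxA mul_mx_diag mxE WE.
  (* The left side is the trace of C^T M C: it is 1, except for n = 0, where it is 0. *)
  have sum1 : \sum_(a <- s) (enorm (a *m B))^-1 *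
      dot (a *m (W^T *m diag_mx d)) (a *m (W^T *m diag_mx d)) <= 1.
    under eq_bigr do rewrite /dot mulr_sumr.
    rewrite exchange_big /=.
    rewrite (eq_bigr (fun=> n%:R^-1)) => [|j _].
      rewrite sumr_const card_ord -[_ *+ n]mulr_natl.
      by case: (n) => [|k]; rewrite ?mul0r// mulfV.
    rewrite (eq_bigr (fun a => (enorm (a *m B))^-1 * dot a (row j W) ^+ 2 * d 0 j ^+ 2)).
      rewrite -mulr_suml -lE dE invfM mulrA mulfV ?mul1r// gt_eqF//.
    by move=> a _; rewrite aC; ring.
  (* |a C| <= (|a B| + |a C|^2 / |a B|) / 2, and both terms sum to at most 1. *)
  have /Bmax : \sum_(a <- s) enorm (a *m (W^T *m diag_mx d)) <= 1.
    apply: (@le_trans _ _ (\sum_(a <- s) (enorm (a *m B) + (enorm (a *m B))^-1 *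
      dot (a *m (W^T *m diag_mx d)) (a *m (W^T *m diag_mx d))) / 2)).
      apply: ler_sum => a _; rewrite -enorm_sqr.
      have [->|a0] := eqVneq a 0.
        rewrite !mul0mx (_ : enorm 0 = 0); last by apply/eqP; rewrite enorm_eq0.
        by rewrite expr0n mulr0 addr0 mul0r.
      have c0 : 0 < enorm (a *m B) by rewrite lt_def enorm_ge0 enorm_unit_eq0// a0.
      rewrite ler_pdivlMr//.
      set c := enorm (a *m B) in c0 *; set t := enorm _.
      have -> : c + c^-1 * t ^+ 2 = t * 2 + c^-1 * (t - c) ^+ 2 by field; rewrite gt_eqF.
      by rewrite lerDl mulr_ge0 ?sqr_ge0// invr_ge0 ltW.
    rewrite -mulr_suml big_split /= ler_pdivrMr// mul1r.
    by rewrite (le_trans (lerD FB sum1)).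
  rewrite det_mulmx det_tr exprMn detW mul1r det_diag -prodrXl.
  rewrite (eq_bigr _ (fun j _ => dE j)) prodfV big_split /= -detM prodr_const card_ord.
  rewrite invfM mulrC ler_pdivrMl//.
  by case: (n) => [|k]; rewrite ?expr0// exprn_gt0.
have upper (A : {set 'I_n}) :
    shadow W (zono g) A <= Num.sqrt (\prod_(j in A) l 0 j) / Num.sqrt ((#|A|)`!)%:R.
  rewrite /shadow zono_image.
  have [|_ up] := @zono_volume_upper _ _ (map_gens (coord_rows W A)^T g).
    by rewrite nonneg_weights_map.
  rewrite -[leLHS]ger0_norm ?rvolume_ge0// -sqrtr_sqr -sqrtrV//.
  have P0 : 0 <= \prod_(j in A) l 0 j by apply: prodr_ge0 => j _; exact: ltW.
  rewrite -sqrtrM// ler_wsqrtr//; apply: (le_trans up).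
  have -> : \det (gram (map_gens (coord_rows W A)^T g)) = \prod_(j in A) l 0 j.
    rewrite gram_map trmxK -/M.
    rewrite (_ : _ *m _ = diag_mx (\row_i l 0 (enum_val i))).
      by rewrite det_diag [RHS]big_enum_val; apply: eq_bigr => i _; rewrite mxE.
    apply/matrixP => i j; transitivity ((W *m M *m W^T) (enum_val i) (enum_val j)).
      rewrite !mxE; apply: eq_bigr => k _; rewrite !mxE; congr (_ * _).
      by apply: eq_bigr => h _; rewrite !mxE.
    by rewrite Wl !mxE (inj_eq enum_val_inj).
  (* The weights sum to at most 1, so their power drops out and the factorial remains. *)
  apply: ler_wpM2l => //; rewrite weights_map weights_weighted_gens.
  rewrite -[leRHS]mul1r; apply: ler_wpM2r; first by rewrite invr_ge0.
  by apply: exprn_ile1 => //; apply: sumr_ge0 => a _; exact: enorm_ge0.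
exists W => // m sigma cov.
apply: (@le_trans _ _ (\prod_(i < m)
    (Num.sqrt (\prod_(j in sigma i) l 0 j) / Num.sqrt ((#|sigma i|)`!)%:R))).
  by apply: ler_prod => i _; rewrite rvolume_ge0 upper.
rewrite prodf_div /bound_const mulrAC; apply: ler_wpM2r.
  by rewrite invr_ge0; apply: prodr_ge0 => i _; exact: sqrtr_ge0.
(* Each index lies in exactly one block, so every eigenvalue is counted once. *)
have -> : \prod_(i < m) Num.sqrt (\prod_(j in sigma i) l 0 j) = Num.sqrt (\det M).
  rewrite detM -(prod_uniform_cover _ cov).
  suff [] : 0 <= \prod_(i < m) \prod_(j in sigma i) l 0 j /\
      \prod_(i < m) Num.sqrt (\prod_(j in sigma i) l 0 j) =
      Num.sqrt (\prod_(i < m) \prod_(j in sigma i) l 0 j) by [].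
  apply: (big_ind2 (fun x y : R => 0 <= y /\ x = Num.sqrt y)) => [|x y z t [y0 ->] [t0 ->]|i _].
  - by rewrite sqrtr1.
  - by rewrite mulr_ge0// sqrtrM.
  - by split => //; apply: prodr_ge0 => j _; exact: ltW.
apply: (@le_trans _ _ (Num.sqrt n%:R ^+ n * (`|\det B| * \det M))); last first.
  by apply: ler_wpM2l => //; rewrite exprn_ge0// sqrtr_ge0.
rewrite -(@ler_pXn2r _ 2)// ?nnegrE ?sqrtr_ge0//; last first.
  by rewrite mulr_ge0 ?exprn_ge0 ?sqrtr_ge0// mulr_ge0// ltW.
rewrite sqr_sqrtr ?(ltW detM0)// !exprMn -exprM mulnC exprM sqr_sqrtr ?ler0n//.
rewrite real_normK ?num_real// [_ ^+ 2 in leRHS]expr2.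
rewrite mulrA [in leRHS]mulrA -[leLHS]mul1r; apply: ler_wpM2r; first exact: ltW.
by move: optimal; rewrite -(ler_pM2r detM0) mulVf ?gt_eqF.
Qed.

End zonotope_theorem.

(** * Passage to zonoids *)

Section thicken.
Variable R : realType.

(** Thickening in the sup norm adds a cube, that is n segments, for which the volume increments are
    known. *)
Definition thicken n (K : set 'rV[R]_n) (delta : R) : set 'rV[R]_n :=
  [set v | exists2 z, K z & forall i, `|v 0 i - z 0 i| <= delta].

Definition cube_sum n (t : R) (l : seq 'I_n) (K : set 'rV[R]_n) :=
  foldr (fun j L => segment_sum L (delta_mx 0 j) t) K l.

Lemma cube_sum_compact n t l (K : set 'rV[R]_n) : compact K -> compact (cube_sum t l K).
Proof. by move=> cK; elim: l => //= j l IH; exact: segment_sum_compact. Qed.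

Lemma cube_sum_convex n t l (K : set 'rV[R]_n) : is_convex K -> is_convex (cube_sum t l K).
Proof. by move=> vK; elim: l => //= j l IH; exact: segment_sum_convex. Qed.

Lemma mem_cube_sum n t l (K : set 'rV[R]_n) (c : 'I_n -> R) z : K z ->
  (forall j, 0 <= c j <= t) ->
  cube_sum t l K (z + \sum_(j <- l) c j *: delta_mx 0 j).
Proof.
move=> Kz c0; elim: l => [|j l IH] /=; first by rewrite big_nil addr0.
by exists (c j) => //; rewrite big_cons (addrC (_ *: _)) addrA addrK.
Qed.

(** Cauchy-Schwarz, from the square of the norm of (v.v) u - (u.v) v. *)
Lemma dot_le_sum n (u v : 'rV[R]_n) : `|dot u v| <= enorm u * enorm v.
Proof.
rewrite -(@ler_pXn2r _ 2)// ?nnegrE ?mulr_ge0 ?enorm_ge0// real_normK ?num_real//.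
rewrite exprMn !enorm_sqr.
have [->|v0] := eqVneq v 0.
  by rewrite dotC !dotE !mul0mx !mxE mulr0 expr0n.
have dv : 0 < dot v v by rewrite dot_gt0.
have := dot_ge0 (dot v v *: u - dot u v *: v).
rewrite dotBl ![dot _ (_ - _)]dotC !dotBl !(dotZl, dotZr) (dotC v u) => h.
rewrite -subr_ge0 -(pmulr_rge0 _ dv).
by move: h; congr (0 <= _); ring.
Qed.

Lemma enorm_triangle n (u v : 'rV[R]_n) : enorm (u + v) <= enorm u + enorm v.
Proof.
rewrite -(@ler_pXn2r _ 2)// ?nnegrE ?addr_ge0 ?enorm_ge0//.
rewrite sqrrD !enorm_sqr dotDl !dotDr (dotC v u).
have := le_trans (ler_norm _) (dot_le_sum u v); rewrite mulr2n; lra.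
Qed.

Lemma enormZ n a (u : 'rV[R]_n) : enorm (a *: u) = `|a| * enorm u.
Proof. by rewrite /enorm dotZl dotZr mulrA -expr2 sqrtrM ?sqr_ge0// sqrtr_sqr. Qed.

Lemma enorm_delta n j : enorm (delta_mx 0 j : 'rV[R]_n) = 1.
Proof. by rewrite /enorm dot_delta sqrtr1. Qed.

Lemma enorm_mulmx_tr m n (V : 'M[R]_(m, n)) (u : 'rV[R]_n) : V *m V^T = 1%:M ->
  enorm (u *m V^T) <= enorm u.
Proof. by move=> VV; rewrite ler_wsqrtr// dot_mulmx_tr. Qed.

Lemma rvolume_bounded n (r : R) : exists2 C : R, 0 <= C &
  forall K : set 'rV[R]_n, compact K -> (forall v, K v -> enorm v <= r) ->
  rvolume K <= C.
Proof.
have [C HC] := volume_bounded n `|r|; exists (Num.max C 0).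
  by rewrite le_max lexx orbT.
move=> K cK Kr; rewrite le_max -lee_fin -rvolumeE// HC// => v Kv.
apply/mx_norm_leP => // i j; rewrite ord1 (le_trans (coord_le_enorm _ _))//.
by rewrite (le_trans (Kr _ Kv))// ler_norm.
Qed.

(** Each segment adds [t] times the volume of a projection of a body that stays in the ball of
    radius r + [size l], as t <= 1. The constant does not depend on [K], so the estimate is uniform
    over all projections of a given body. *)
Lemma rvolume_cube_sum n (l : seq 'I_n) (r : R) : exists2 c : R, 0 <= c &
  forall K, compact K -> is_convex K -> (forall v, K v -> enorm v <= r) ->
  forall t, 0 <= t <= 1 -> rvolume (cube_sum t l K) <= rvolume K + c * t.
Proof.
case: n l => [|n] l.
  by exists 0 => // K _ _ _ t _; case: l => [|[]//]; rewrite mul0r addr0.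
elim: l => [|j l [c c0 IH]]; first by exists 0 => // K _ _ _ t _; rewrite mul0r addr0.
have ej0 : delta_mx 0 j != 0 :> 'rV[R]_n.+1 by rewrite -dot_eq0 dot_delta oner_eq0.
have [V [VV Vvol _]] := segment_step ej0.
have [C C0 HC] := rvolume_bounded n (r + (size l)%:R).
exists (c + C); first exact: addr_ge0.
move=> K cK vK Kr t /[dup] t01 /andP[t0 t1].
have cS : compact (cube_sum t l K) by exact: cube_sum_compact.
have vS : is_convex (cube_sum t l K) by exact: cube_sum_convex.
have Sr v : cube_sum t l K v -> enorm v <= r + (size l)%:R.
  elim: (l) v => [|i l' IHl] v /=; first by move=> /Kr; rewrite addr0.
  move=> [s /andP[s0 st] /IHl h].
  rewrite -[v](subrK (s *: delta_mx 0 i)) (le_trans (enorm_triangle _ _))//.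
  rewrite enormZ enorm_delta mulr1 ger0_norm// -natr1 addrA lerD//.
  exact: le_trans st t1.
have cV : compact [set v *m V^T | v in cube_sum t l K] by exact: compact_image_mulmx.
have -> : rvolume (cube_sum t (j :: l) K) = rvolume (cube_sum t l K) +
    t * rvolume [set v *m V^T | v in cube_sum t l K].
  apply: EFin_inj; rewrite -rvolumeE; last exact: (@cube_sum_compact _ t (j :: l)).
  rewrite -[cube_sum t (j :: l) K]/(segment_sum (cube_sum t l K) (delta_mx 0 j) t).
  by rewrite Vvol// enorm_delta mulr1 (rvolumeE cS) (rvolumeE cV).
rewrite mulrDl addrA; apply: lerD; first exact: IH.
rewrite mulrC; apply: ler_wpM2r => //; apply: HC => // _ [v Kv <-].
exact: le_trans (enorm_mulmx_tr _ VV) (Sr _ Kv).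
Qed.

Lemma thicken_compact n (K : set 'rV[R]_n) delta : compact K -> compact (thicken K delta).
Proof.
move=> cK.
pose C : set 'rV[R]_n := [set v | forall i, `[- delta, delta]%classic (v ord0 i)].
have -> : thicken K delta = (fun p : 'rV[R]_n * 'rV[R]_n => p.1 + p.2) @` (K `*` C).
  apply/seteqP; split => [v [z Kz vz]|_ [[z c] [/= Kz Cc] <-]].
    exists (z, v - z); rewrite /= ?subrKC//; split => // i.
    by rewrite /= in_itv/= !mxE -ler_norml.
  exists z => // i; rewrite mxE addrAC subrr add0r ler_norml.
  by have := Cc i; rewrite /= in_itv.
apply: continuous_compact; last first.
  apply: compact_setX => //.
  by apply: (@rV_compact _ _ (fun=> `[- delta, delta]%classic)) => i; exact: segment_compact.
apply: continuous_subspaceT; apply: mx_continuous => i j.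
under [X in continuous X]eq_fun do rewrite mxE.
move=> p; apply: cvgD.
  by apply: (@cvg_comp _ _ _ fst (fun M : 'rV[R]_n => M i j)); [exact: cvg_fst|exact: coord_continuous].
by apply: (@cvg_comp _ _ _ snd (fun M : 'rV[R]_n => M i j)); [exact: cvg_snd|exact: coord_continuous].
Qed.

Lemma rvolume_translate n (K : set 'rV[R]_n) p : compact K ->
  rvolume [set v | K (v + p)] = rvolume K.
Proof. by move=> cK; rewrite /rvolume volume_translate. Qed.

Lemma translate_compact n (K : set 'rV[R]_n) p : compact K ->
  compact [set v | K (v + p)].
Proof.
move=> /(@compact_preimage_linear _ _ _ 1%:M p (unitmx1 _ _)); congr compact.
by apply/funext => v /=; rewrite mulmx1.
Qed.

Lemma rvolume_thicken n (r : R) : exists2 c : R, 0 <= c &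
  forall K : set 'rV[R]_n, compact K -> is_convex K -> (forall v, K v -> enorm v <= r) ->
  forall delta, 0 <= delta -> delta * 2 <= 1 ->
    rvolume (thicken K delta) <= rvolume K + c * delta.
Proof.
have [c c0 Hc] := rvolume_cube_sum (index_enum 'I_n) r.
exists (c * 2); first by rewrite mulr_ge0.
move=> K cK vK Kr delta d0 d1.
pose S := cube_sum (delta * 2) (index_enum 'I_n) K.
have cS : compact S by exact: cube_sum_compact.
rewrite -mulrA (mulrC 2); apply: (@le_trans _ _ (rvolume S)); last first.
  by apply: Hc => //; rewrite mulr_ge0.
(* The thickening adds the cube [-delta, delta]^n and [S] the cube [0, 2 delta]^n; this translation
   aligns them. *)
rewrite -(rvolume_translate (const_mx delta) cS); apply: rvolume_le.
- exact: thicken_compact.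
- exact: translate_compact.
move=> v [z Kz vz] /=.
have -> : v + const_mx delta = z + \sum_(j <- index_enum 'I_n)
    (v 0 j - z 0 j + delta) *: delta_mx 0 j.
  apply/rowP => i; rewrite !mxE summxE (bigD1 i)//= big1 => [|j ji].
    by rewrite !mxE !eqxx /=; ring.
  by rewrite !mxE eq_sym (negbTE ji) mulr0.
apply: mem_cube_sum => // j.
by have := vz j; rewrite ler_norml => /andP[? ?]; apply/andP; split; lra.
Qed.

(** If |z| <= r on [Z], replacing [W'] by [W] moves each coordinate of a projected point by at most
    d r e, so one projection lies in a thickening of the other. Orthogonality of [W'] keeps the
    thickened projection in the ball of radius r. *)
Lemma shadow_lipschitz d (Z : set 'rV[R]_d) (A : {set 'I_d}) :
  compact Z -> is_convex Z ->
  exists c e0 : R, [/\ 0 <= c, 0 < e0 & forall (W W' : 'M[R]_d) e,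
    W' *m W'^T = 1%:M -> 0 <= e <= e0 ->
    (forall i j, `|W i j - W' i j| <= e) ->
    shadow W Z A <= shadow W' Z A + c * e].
Proof.
move=> cZ vZ.
have [r r0 Zr] : exists2 r : R, 0 <= r & forall z, Z z -> enorm z <= r.
  have cE : {within Z, continuous (@enorm R d)}.
    by apply: continuous_subspaceT; apply: enorm_continuous => x; exact: cvg_id.
  have [->|/set0P Z0] := eqVneq Z set0; first by exists 0.
  have [z zZ zm] := compact_EVT_max Z0 cZ cE.
  by exists (enorm z); [exact: enorm_ge0|move=> y Zy; apply: zm; rewrite inE].
have [c c0 Hc] := rvolume_thicken #|A| r.
pose k := d%:R * r.
have k0 : 0 <= k by rewrite mulr_ge0.
(* For e up to this value, 2 k e <= 1, as [rvolume_thicken] asks; the added 1 covers k = 0. *)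
exists (c * k), ((k * 2 + 1)^-1); split; rewrite ?mulr_ge0//.
  by rewrite invr_gt0; lra.
move=> W W' e WW' /andP[e0 e1] We.
have VV : coord_rows W' A *m (coord_rows W' A)^T = 1%:M.
  apply/matrixP => i j; transitivity ((W' *m W'^T) (enum_val i) (enum_val j)).
    by rewrite !mxE; apply: eq_bigr => l _; rewrite !mxE.
  by rewrite WW' !mxE (inj_eq enum_val_inj).
have ke : k * e * 2 <= 1.
  have : (k * 2 + 1) * e <= 1 by rewrite mulrC -ler_pdivlMr ?div1r//; lra.
  lra.
have cW (X : 'M[R]_d) : compact [set z *m (coord_rows X A)^T | z in Z].
  exact: compact_image_mulmx.
rewrite -mulrA; apply: (@le_trans _ _
  (rvolume (thicken [set z *m (coord_rows W' A)^T | z in Z] (k * e)))).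
  apply: rvolume_le => //; first exact: thicken_compact.
  move=> _ [z Zz <-]; exists (z *m (coord_rows W' A)^T); first by exists z.
  move=> i; rewrite !mxE -sumrB (le_trans (ler_norm_sum _ _ _))//.
  rewrite /k -mulrA mulr_natl -[in leRHS](card_ord d) -sumr_const; apply: ler_sum => j _.
  rewrite !mxE -mulrBr normrM ler_pM//.
  exact: le_trans (coord_le_enorm _ _) (Zr _ Zz).
apply: Hc => //.
- exact: convex_image_mulmx.
- by move=> _ [z Zz <-]; exact: le_trans (enorm_mulmx_tr _ VV) (Zr _ Zz).
- exact: mulr_ge0.
Qed.

End thicken.

(** * Enclosing a zonoid in zonotopes *)

Section zonoid.
Variable R : realType.

Lemma mem_zono_unit_gens n (I : eqType) (r : seq I) (f : I -> 'rV[R]_n) (t : I -> R) :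
  (forall i, 0 <= t i <= 1) ->
  zono (unit_gens [seq f i | i <- r]) (\sum_(i <- r) t i *: f i).
Proof.
move=> t01; elim: r => [|i r IH] /=; first by rewrite big_nil.
by exists (t i) => //; rewrite big_cons addrAC subrr add0r.
Qed.

Lemma zono_unit_gensP n (I : eqType) (r : seq I) (f : I -> 'rV[R]_n) v :
  uniq r -> zono (unit_gens [seq f i | i <- r]) v ->
  exists t : I -> R, (forall i, 0 <= t i <= 1) /\ v = \sum_(i <- r) t i *: f i.
Proof.
elim: r v => [|i r IH] v /=.
  by move=> _ ->; exists (fun=> 0); rewrite big_nil lexx ler01; split.
move=> /andP[ir ur] [s s01 /(IH _ ur)[t [t01 vt]]].
exists (fun j => if j == i then s else t j); split.
  by move=> j; case: ifP.
rewrite big_cons eqxx (_ : \sum_(j <- r) _ = \sum_(j <- r) t j *: f j).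
  by rewrite -vt addrC subrK.
apply: eq_big_seq => j jr; case: ifP => // /eqP ji.
by rewrite -ji jr in ir.
Qed.

Lemma excess_lt n (A B : set 'rV[R]_n) (delta : R) a :
  (ereal_sup [set ereal_inf [set (enorm (a - b))%:E | b in B] | a in A] < delta%:E)%E ->
  A a -> exists2 b, B b & enorm (a - b) < delta.
Proof.
move=> supd Aa.
have : (ereal_inf [set (enorm (a - b))%:E | b in B] < delta%:E)%E.
  by apply: le_lt_trans supd; apply: ereal_sup_ubound; exists a.
by move=> /ereal_inf_lt[_ [b Bb <-]]; rewrite lte_fin => h; exists b.
Qed.

(** The enclosing zonotope is [Y] plus the cube [-delta, delta]^n: the cube makes up for the
    distance to [Z], and costs a second delta in the other inclusion. Its edges are the generators
    that [zonotope_shadows] asks for. *)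
Lemma zonotope_thicken n (Y Z : set 'rV[R]_n) (delta : R) : 0 < delta ->
  zonotope Y -> (hausdorff_dist Y Z < delta%:E)%E ->
  exists (s : seq 'rV[R]_n) q, [/\ forall j, (delta * 2) *: delta_mx 0 j \in s,
    Z `<=` [set v | zono (unit_gens s) (v + q)] &
    [set v | zono (unit_gens s) (v + q)] `<=` thicken Z (delta * 2)].
Proof.
move=> d0 [k [a [b ->]]]; rewrite /hausdorff_dist gt_max => /andP[YZ ZY].
pose I := ('I_k + 'I_n)%type.
pose f (i : I) : 'rV[R]_n := match i with inl i => b i - a i | inr j => (delta * 2) *: delta_mx 0 j end.
(* [zono] has its base vertex at 0, while that of [Y] plus the cube is the sum of the [a i] minus
   [const_mx delta]; [q] is the opposite of this vertex. *)
pose q : 'rV[R]_n := const_mx delta - \sum_i a i.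
have sumE (t : I -> R) : \sum_i t i *: f i - q =
    \sum_i ((1 - t (inl i)) *: a i + t (inl i) *: b i) +
    (\sum_j (t (inr j) * (delta * 2)) *: delta_mx 0 j - const_mx delta).
  rewrite big_sumType /= [in RHS](eq_bigr (fun i => a i + t (inl i) *: (b i - a i))) => [|i _].
    rewrite big_split /= [in LHS](eq_bigr (fun j => (t (inr j) * (delta * 2)) *: delta_mx 0 j)) => [|j _].
      rewrite /q opprB addrA [RHS]addrA; congr (_ - _).
      by rewrite [LHS]addrC addrA.
    by rewrite scalerA.
  by rewrite scalerBl scale1r scalerBr -addrA (addrC (- _)).
have coordE (c : 'I_n -> R) i : (\sum_j c j *: delta_mx 0 j - const_mx delta : 'rV[R]_n) 0 i =
    c i - delta.
  rewrite !mxE summxE (bigD1 i)//= big1 => [|j ji]; first by rewrite !mxE !eqxx mulr1 addr0.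
  by rewrite !mxE eq_sym (negbTE ji) mulr0.
exists [seq f i | i <- index_enum I], q; split.
- by move=> j; apply/mapP; exists (inr j) => //; rewrite mem_index_enum.
- move=> z Zz /=; have [y [x xs <-] zy] := excess_lt ZY Zz.
  have {}xs i : exists t : R, 0 <= t <= 1 /\ (1 - t) *: a i + t *: b i = x i.
    by have [t ? ?] := xs i; exists t.
  have [t tx] := choice xs.
  pose c : 'rV[R]_n := z - \sum_i x i.
  have cd j : `|c 0 j| <= delta by rewrite (le_trans (coord_le_enorm _ _))// ltW.
  pose T (i : I) : R := match i with inl i => t i | inr j => (c 0 j + delta) / (delta * 2) end.
  have dd : 0 < delta * 2 by rewrite mulr_gt0.
  have T01 i : 0 <= T i <= 1.
    case: i => [i|j] /=; first by have [] := tx i.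
    have := cd j; rewrite ler_norml => /andP[c1 c2].
    by rewrite divr_ge0 ?(ltW dd)//= ?ler_pdivrMr//; lra.
  rewrite (_ : z + q = \sum_i T i *: f i); first exact: mem_zono_unit_gens.
  apply/eqP; rewrite eq_sym -subr_eq sumE /= (eq_bigr x) => [|i _]; last by have [] := tx i.
  rewrite addrC eq_sym -subr_eq -/c; apply/eqP/rowP => j.
  by rewrite coordE divfK ?gt_eqF// addrK.
- move=> v /= /zono_unit_gensP[]; first exact: index_enum_uniq.
  move=> t [t01 vq].
  have vE : v = \sum_i t i *: f i - q by rewrite -vq addrK.
  pose y := \sum_i ((1 - t (inl i)) *: a i + t (inl i) *: b i).
  have [z Zz yz] : exists2 z, Z z & enorm (y - z) < delta.
    apply: (excess_lt YZ); exists (fun i => (1 - t (inl i)) *: a i + t (inl i) *: b i) => //= i.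
    by exists (t (inl i)) => //=; rewrite in_itv/= t01.
  exists z => // j.
  have h1 : `|y 0 j - z 0 j| <= delta.
    by have := le_trans (coord_le_enorm (y - z) j) (ltW yz); rewrite !mxE.
  have h2 : `|v 0 j - y 0 j| <= delta.
    rewrite vE sumE -/y [X in X - _]mxE coordE addrAC subrr add0r ler_norml.
    have /andP[t0 t1] := t01 (inr j).
    have : t (inr j) * (delta * 2) <= delta * 2 by rewrite ler_piMl// mulr_ge0// ltW.
    have : 0 <= t (inr j) * (delta * 2) by rewrite mulr_ge0// mulr_ge0// ltW.
    by move=> ? ?; apply/andP; split; lra.
  rewrite -[v 0 j - _](subrKA (y 0 j)) (le_trans (ler_normD _ _))//; lra.
Qed.

Lemma zonoid_approx n (Z : set 'rV[R]_n) (delta : R) : zonoid Z -> 0 < delta ->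
  exists (s : seq 'rV[R]_n) q, [/\ (exists2 eta, 0 < eta & forall j, eta *: delta_mx 0 j \in s),
    Z `<=` [set v | zono (unit_gens s) (v + q)] &
    [set v | zono (unit_gens s) (v + q)] `<=` thicken Z delta].
Proof.
move=> [cZ [Y Yz YZ]] d0.
have d2 : 0 < delta / 2 by rewrite divr_gt0.
have lt0 : nbhs (0%E : \bar R) [set y | (y < (delta / 2)%:E)%E].
  by apply: open_nbhs_nbhs; split; [exact: open_ereal_lt_ereal|rewrite /= lte_fin].
have [k _ /(_ k (leqnn k)) /= Yk] := YZ _ lt0.
have [s [q]] := zonotope_thicken d2 (Yz k) Yk.
rewrite divfK ?pnatr_eq0// => -[h1 h2 h3].
by exists s, q; split => //; exists delta.
Qed.

Lemma thicken_cap n (Z : set 'rV[R]_n) v : compact Z ->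
  (forall delta, 0 < delta -> thicken Z delta v) -> Z v.
Proof.
move=> cZ Zv.
have /closure_id -> : closed Z by exact: compact_closed.
move=> U /nbhs_ballP[e /= e0 eU].
have [z Zz vz] := Zv (e / 2) ltac:(by rewrite divr_gt0).
exists z; split => //; apply: eU; split => // i j.
rewrite ord1 -ball_normE /=; apply: le_lt_trans (vz j) _.
by rewrite ltr_pdivrMr// ltr_pMr// ltr1n.
Qed.

(** A segment with ends in [Z] stays in every enclosing zonotope, hence in every thickening of
    [Z]. *)
Lemma zonoid_convex n (Z : set 'rV[R]_n) : zonoid Z -> is_convex Z.
Proof.
move=> zZ x y t Zx Zy t01; apply: thicken_cap; first by have [] := zZ.
move=> delta d0; have [s [q [_ Zs sZ]]] := zonoid_approx zZ d0.
apply: sZ => /=; have := zono_convex (Zs _ Zx) (Zs _ Zy) t01; congr zono.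
by rewrite !scalerDr addrACA -scalerDl addrCA subrr addr0 scale1r.
Qed.

Lemma rvolume_thicken_cvg n (Z : set 'rV[R]_n) : compact Z ->
  rvolume (thicken Z j.+1%:R^-1) @[j --> \oo] --> rvolume Z.
Proof.
move=> cZ; apply: fine_cvg.
rewrite -rvolumeE//.
have ZE : Z = \bigcap_j thicken Z j.+1%:R^-1.
  apply/seteqP; split => [z Zz j _|z Zz].
    by exists z => // i; rewrite subrr normr0.
  apply: thicken_cap => // delta d0.
  have [j _ /(_ j (leqnn j)) /= jd] := near_infty_natSinv_lt (PosNum d0).
  have [y Zy zy] := Zz j I; exists y => // i.
  exact: le_trans (zy i) (ltW jd).
rewrite [X in _ --> volume X]ZE; apply: volume_decreasing_cvg => [j|j v [z Zz vz]]; first exact: thicken_compact.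
exists z => // i; apply: le_trans (vz i) _.
by rewrite lef_pV2 ?posrE// ler_nat.
Qed.

End zonoid.

(** * Limit of the bases in the orthogonal group *)

Section limit.
Variable R : realType.

Lemma orthogonal_compact n : compact [set W : 'M[R]_n | W *m W^T = 1%:M].
Proof.
apply: (@bounded_closed_compact_mx _ _ _ _ 1).
  move=> W i j /= WW; rewrite -[W i j](_ : row i W 0 j = _); last by rewrite mxE.
  rewrite (le_trans (coord_le_enorm _ _))// /enorm (_ : dot _ _ = 1) ?sqrtr1//.
  have /matrixP/(_ i i) := WW; rewrite !mxE eqxx mulr1n => WWi; apply: etrans WWi.
  by apply: eq_bigr => k _; rewrite !mxE.
apply: (@closed_comp _ _ (fun W : 'M[R]_n => W *m W^T) [set 1%:M]).
  move=> W _; apply: mulmx_continuous => {}W; first exact: cvg_id.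
  apply: (@mx_continuous _ _ _ _ (fun W : 'M[R]_n => W^T)) => i j.
  by under [X in continuous X]eq_fun do rewrite mxE; exact: coord_continuous.
exact/accessible_closed_set1/hausdorff_accessible/norm_hausdorff.
Qed.

Lemma bound_const_ge0 n m (sigma : 'I_m -> {set 'I_n}) : 0 <= bound_const R sigma.
Proof.
rewrite divr_ge0 ?exprn_ge0 ?sqrtr_ge0//.
by apply: prodr_ge0 => i _; exact: sqrtr_ge0.
Qed.

(** The shadows of [Z] are at most those of an enclosing zonotope, whose volume is at most that of
    the thickening; the translation by [q] changes none of these volumes. *)
Lemma zonoid_approx_shadows n (Z : set 'rV[R]_n) (delta : R) : zonoid Z -> 0 < delta ->
  exists W : 'M[R]_n, W *m W^T = 1%:M /\
    forall m (sigma : 'I_m -> {set 'I_n}), uniform_cover 1 sigma ->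
      \prod_(i < m) shadow W Z (sigma i) <=
      bound_const R sigma * rvolume (thicken Z delta).
Proof.
move=> zZ d0; have cZ : compact Z by have [] := zZ.
have [s [q [[eta e0 es] Zs sZ]]] := zonoid_approx zZ d0.
have [W WW HW] := zonotope_shadows e0 es; exists W; split => // m sigma cov.
have cs : compact (zono (unit_gens s)) by exact: zono_compact.
have := HW m sigma cov; set S := zono (unit_gens s) in Zs sZ cs * => HS.
apply: (@le_trans _ _ (\prod_(i < m) shadow W S (sigma i))).
  apply: ler_prod => i _; rewrite rvolume_ge0 /=.
  have cI (X : set 'rV[R]_n) : compact X ->
      compact [set z *m (coord_rows W (sigma i))^T | z in X].
    exact: compact_image_mulmx.
  rewrite /shadow -(@rvolume_translate _ _ [set _ | _ in S] (q *m (coord_rows W (sigma i))^T)); last exact: cI.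
  apply: rvolume_le; [exact: cI|by apply: translate_compact; exact: cI|].
  move=> _ [z Zz <-] /=; exists (z + q); first exact: Zs.
  by rewrite mulmxDl.
apply: (le_trans HS); apply: ler_wpM2l; first exact: bound_const_ge0.
rewrite -(rvolume_translate q cs); apply: rvolume_le => //.
  exact: translate_compact.
exact: thicken_compact.
Qed.

(** [P] is a cluster point of bases [W k] that work for [Z] up to a thickening by 1/(k+1). As the
    [W k] do not depend on the cover, [P] is fixed before it; a strict failure at [P] for some cover
    would persist at a [W j] near [P] with large j. *)
Lemma zonoid_shadows n (Z : set 'rV[R]_n) : zonoid Z ->
  exists W : 'M[R]_n, W *m W^T = 1%:M /\
    forall m (sigma : 'I_m -> {set 'I_n}), uniform_cover 1 sigma ->
      \prod_(i < m) shadow W Z (sigma i) <= bound_const R sigma * rvolume Z.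
Proof.
move=> zZ; have cZ : compact Z by have [] := zZ.
have vZ := zonoid_convex zZ.
have [W HW] := choice (fun k => @zonoid_approx_shadows n Z k.+1%:R^-1 zZ
  ltac:(by rewrite invr_gt0)).
have [|P [PP clP]] := @orthogonal_compact n (W @ \oo) _.
  by exists 0%N => // k _ /=; have [] := HW k.
exists P; split => // m sigma cov; rewrite leNgt; apply/negP => ltP.
pose x i := shadow P Z (sigma i).
(* A lower bound for the product at bases near [P]. Truncating at 0 keeps the factors nonnegative,
   so that the products compare factor by factor. *)
pose g e := \prod_(i < m) Num.max (x i - e) 0.
have gc : continuous g.
  apply: prod_continuous => i e; apply: (@continuous_max _ _ (fun e => x i - e) (cst 0)); last exact: cst_continuous.
  by apply: continuousB; [exact: cst_continuous|exact: cvg_id].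
have g0 : g 0 = \prod_(i < m) x i.
  by apply: eq_bigr => i _; rewrite subr0 max_l// rvolume_ge0.
pose c := (bound_const R sigma * rvolume Z + g 0) / 2.
have c1 : bound_const R sigma * rvolume Z < c by rewrite /c g0 /x; lra.
have c2 : c < g 0 by rewrite /c g0 /x; lra.
have [r /= r0 gr] : exists2 r : R, 0 < r & forall e, `|e| < r -> c < g e.
  have /nbhs_ballP[r /= r0 rg] := gc 0 _ (lt_nbhsr c2).
  exists r => // e er; apply: rg => /=; rewrite -ball_normE /= sub0r normrN//.
have hc : bound_const R sigma * rvolume (thicken Z j.+1%:R^-1) @[j --> \oo] -->
    bound_const R sigma * rvolume Z.
  by apply: cvgMr; exact: rvolume_thicken_cvg.
have [N _ HN] := hc _ (lt_nbhsl c1).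
have [ce Hce] := choice (fun i => shadow_lipschitz (sigma i) cZ vZ).
have [e0 He0] := choice Hce.
have [e [e_gt0 He]] : exists e : R, 0 < e /\ forall i, e <= e0 i /\ ce i * e <= r / 2.
  have : \forall e \near (0 : R)^'+, forall i, e <= e0 i /\ ce i * e <= r / 2.
    apply: filter_forall => i; have [ci0 ei0 _] := He0 i.
    near=> e; split; first by near: e; exact: nbhs_right_le.
    apply: (@le_trans _ _ ((ce i + 1) * e)).
      by apply: ler_wpM2r; [near: e; exact: nbhs_right_ge|rewrite lerDl].
    rewrite mulrC -ler_pdivlMr ?ltr_wpDl//; near: e; apply: nbhs_right_le.
    by rewrite !divr_gt0// ltr_wpDl.
  move=> /(filterI (nbhs_right_gt 0))/filter_ex[e [/= e_gt0 He]].
  by exists e.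
(* The cluster property gives one index beyond [N], where the thickened volume is under control,
   with [W j] within [e] of [P]. *)
have nP : nbhs P (ball P e) by exact: nbhsx_ballx.
have WN : (W @ \oo) [set W j | j in [set j | (N <= j)%N]].
  by exists N => // j Nj; exists j.
have [_ [[j Nj <-] Wj]] := clP _ _ WN nP.
have [WW Wbound] := HW j.
have := Wbound m sigma cov; apply/negP; rewrite -ltNge.
apply: (lt_trans (HN j Nj)); apply: (lt_le_trans (gr (r / 2) _)).
  by rewrite gtr0_norm ?divr_gt0// ltr_pdivrMr// ltr_pMr// ltr1n.
apply: ler_prod => i _; rewrite le_max lexx orbT /=.
have [_ e0i lip] := He0 i; have [ei cei] := He i.
rewrite ge_max rvolume_ge0 andbT lerBlDr.
apply: (le_trans (lip P (W j) e WW _ _)).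
- by rewrite (ltW e_gt0).
- by move=> a b; apply: ltW; have [_ /(_ a b)] := Wj; rewrite -ball_normE.
- by rewrite lerD2l.
Unshelve. all: by end_near. Qed.

End limit.

(** * Volumes in subspaces *)

Section subspace.
Variable R : realType.

(** Two orthonormal bases of a subspace differ by an orthogonal matrix [Q], so the arbitrary basis
    inside [subspace_volume] can be exchanged for rows of [W]. *)
Lemma volume_orthonormal_coords r k d (B : 'M[R]_(r, d)) (V : 'M[R]_(k, d)) (Z : set 'rV[R]_d) :
  B *m B^T = 1%:M -> V *m V^T = 1%:M -> (B :=: V)%MS -> compact Z ->
  volume [set z *m B^T | z in Z] = volume [set z *m V^T | z in Z].
Proof.
move=> BB VV BV cZ.
have rk m (C : 'M[R]_(m, d)) : C *m C^T = 1%:M -> \rank C = m.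
  move=> CC; apply/eqP; rewrite eqn_leq rank_leq_row /= -[X in (X <= _)%N](mxrank1 R m) -CC.
  exact: mxrankM_maxl.
have rkE : r = k by rewrite -(rk _ _ BB) -(rk _ _ VV) BV.
subst k; have /submxP[Q BE] : (B <= V)%MS by rewrite BV.
have QQ : Q *m Q^T = 1%:M.
  by rewrite -BB BE trmx_mul -mulmxA (mulmxA V) VV mul1mx.
have QQ' := mulmx1C QQ.
have cV : compact [set z *m V^T | z in Z] by exact: compact_image_mulmx.
rewrite -(volume_preimage_orthogonal QQ cV).
congr volume; apply/seteqP; split => [_ [z Zz <-]|c [z Zz zc]] /=.
  by exists z => //; rewrite BE trmx_mul -!mulmxA QQ' mulmx1.
by exists z => //; rewrite BE trmx_mul mulmxA zc -mulmxA QQ mulmx1.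
Qed.

Lemma subspace_volume_shadow d (w : 'I_d -> 'rV[R]_d) (A : {set 'I_d}) (Z : set 'rV[R]_d) :
  orthonormal_family w -> compact Z ->
  subspace_volume (span_of w A) [set z *m orthproj (span_of w A) | z in Z] =
  (shadow (\matrix_i w i) Z A)%:E.
Proof.
move=> ow cZ; rewrite -rvolumeE; last exact: compact_image_mulmx.
set E := span_of w A; pose V := coord_rows (\matrix_i w i) A.
rewrite /subspace_volume; set B := xget _ _.
have [oB BE] : orthonormal_basis_of E B.
  by apply: (@xgetPex _ 0 (orthonormal_basis_of E)); exact: orthonormal_basis_of_neq0.
have BB : B *m B^T = 1%:M.
  apply/matrixP => i j; have := oB i j; rewrite !mxE => <-.
  by apply: eq_bigr => l _; rewrite !mxE.
have VV : V *m V^T = 1%:M.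
  apply/matrixP => i j; have := ow (enum_val i) (enum_val j).
  rewrite !mxE (inj_eq enum_val_inj) => <-.
  by apply: eq_bigr => l _; rewrite !mxE.
have rowV i : row i V = w (enum_val i) by apply/rowP => j; rewrite !mxE.
have VE : (V :=: E)%MS.
  apply/eqmxP/andP; split.
    apply/row_subP => i; rewrite rowV.
    by rewrite (sumsmx_sup (enum_val i)) ?enum_valP// genmxE.
  apply/sumsmx_subP => j jA; rewrite genmxE.
  by rewrite -[j](enum_rankK_in jA)// -rowV row_sub.
rewrite -(volume_orthonormal_coords BB VV (eqmx_trans BE (eqmx_sym VE)) cZ).
have [X BX] : exists X, B = X *m E by apply/submxP; rewrite BE.
(* A vector minus its projection is orthogonal to [E], hence to the rows of [B], which lie in
   [E]. *)
have projB (z : 'rV[R]_d) : z *m orthproj E *m B^T = z *m B^T.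
  have /(congr1 (mulmx^~ X^T)) := orthproj_orth E z.
  rewrite -mulmxA -trmx_mul -BX mul0mx mulmxBl => /eqP.
  by rewrite subr_eq0 => /eqP.
congr volume; apply/seteqP; split => [c [z Zz zc]|_ [z Zz <-]].
  by exists z => //; rewrite -projB zc -mulmxA BB mulmx1.
exists z => //.
have /submxP[y zy] : (z *m orthproj E <= B)%MS by rewrite BE orthproj_sub.
by rewrite -projB zy -(mulmxA y) BB mulmx1.
Qed.

End subspace.

Theorem corollary5p9 (R : realType) (d : nat) (Z : set 'rV[R]_d) :
  zonoid Z ->
  exists w : 'I_d -> 'rV[R]_d, orthonormal_family w /\
    forall (m : nat) (sigma : 'I_m -> {set 'I_d}), uniform_cover 1 sigma ->
      (\prod_(i < m)
          subspace_volume (span_of w (sigma i))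
            [set (z *m orthproj (span_of w (sigma i)))%R | z in Z]
       <= (Num.sqrt d%:R ^+ d / \prod_(i < m) Num.sqrt ((#|sigma i|)`!)%:R)%R%:E
          * volume Z)%E.
Proof.
move=> zZ; have cZ : compact Z by have [] := zZ.
have [W [WW HW]] := zonoid_shadows zZ.
have ow : orthonormal_family (fun i => row i W).
  move=> i j; have /matrixP/(_ i j) := WW; rewrite !mxE => <-.
  by apply: eq_bigr => k _; rewrite !mxE.
exists (fun i => row i W); split => // m sigma cov.
under eq_bigr do rewrite subspace_volume_shadow//.
rewrite prodEFin rvolumeE// -EFinM lee_fin.
have -> : \matrix_i row i W = W by apply/row_matrixP => i; rewrite rowK.
exact: HW.
Qed.
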